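(* Let $\mathcal{H}$ be a Hilbert $C^*$-module over a unital $C^*$-algebra $\mathcal{A}$ and let $\{\mathcal{H}_j\}_{j\in J}$ be a family of closed submodules of $\mathcal{H}$. Let $C,C'\in GL^+(\mathcal{H})$, let $\Lambda_j\in End_{\mathcal{A}}^*(\mathcal{H},\mathcal{H}_j)$ for $j\in J$, and suppose that $C$ and $C'$ commute with each other and commute with $\Lambda_j^*\Lambda_j$ for all $j\in J$. Then $\{\Lambda_j:j\in J\}$ is a $(C,C')$-controlled g-Bessel sequence for $\mathcal{H}$ with respect to $\{\mathcal{H}_j\}_{j\in J}$ with bound $B$ if and only if the operator $T_{(C,C')}:l^2(\{\mathcal{H}_j\}_{j\in J})\to\mathcal{H}$ given by $$T_{(C,C')}(\{g_j\}_{j\in J})=\sum_{j\in J}(CC')^{\frac12}\Lambda_j^*g_j,\qquad \{g_j\}_{j\in J}\in l^2(\{\mathcal{H}_j\}_{j\in J}),$$ is a well-defined and bounded operator with $\|T_{(C,C')}\|\le\sqrt{B}$.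
   Context: $\mathcal{A}$ is a unital $C^*$-algebra, and $\mathcal{H}$ is a (left) Hilbert $\mathcal{A}$-module with $\mathcal{A}$-valued inner product $\langle\cdot,\cdot\rangle$ ($\mathcal{A}$-linear in the first variable) and norm $\|f\|=\|\langle f,f\rangle\|^{1/2}$. $J$ is any index set. $End_{\mathcal{A}}^*(\mathcal{H},\mathcal{H}_j)$ is the set of adjointable $\mathcal{A}$-linear operators $\mathcal{H}\to\mathcal{H}_j$. $GL^+(\mathcal{H})$ is the set of all positive bounded linear invertible operators on $\mathcal{H}$ with bounded inverse; $(CC')^{1/2}$ is the positive square root of the positive operator $CC'$. $l^2(\{\mathcal{H}_j\}_{j\in J})$ is the Hilbert $\mathcal{A}$-module of families $\{g_j\}_{j\in J}$, $g_j\in\mathcal{H}_j$, for which $\sum_{j\in J}\langle g_j,g_j\rangle$ converges in norm in $\mathcal{A}$, with inner product $\langle\{f_j\},\{g_j\}\rangle=\sum_{j\in J}\langle f_j,g_j\rangle$. A family $\{\Lambda_j\in End_{\mathcal{A}}^*(\mathcal{H},\mathcal{H}_j):j\in J\}$ is a $(C,C')$-controlled g-Bessel sequence for $\mathcal{H}$ with respect to $\{\mathcal{H}_j\}_{j\in J}$ with bound $B$, $0<B<\infty$, if $\sum_{j\in J}\langle\Lambda_jCf,\Lambda_jC'f\rangle\le B\langle f,f\rangle$ for all $f\in\mathcal{H}$. *)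

(* Defs.v *)
From HB Require Import structures.
From mathcomp Require Import all_boot all_order all_algebra.
From mathcomp Require Import complex finmap.
From mathcomp Require Import all_classical all_reals all_analysis.
From mathcomp.analysis.showcase Require Import summability.

Set Implicit Arguments.
Unset Strict Implicit.
Unset Printing Implicit Defensive.

Import Order.TTheory GRing.Theory Num.Theory.
Import numFieldNormedType.Exports.

Local Open Scope classical_set_scope.
Local Open Scope ring_scope.

(* C*-algebras with unit over R[i], with R-valued norm.  MathComp has no common
   substructure of normed modules and of rings with an abstract norm, so the
   product and the complex scaling are fields of the mixin and the ring and
   R[i]-module instances are derived from them below. *)
HB.mixin Record isCstarAlgebra (R : realType) A
    of PseudoMetricNormedZmod R A := {
  cstar_complete : forall F : set_system A, ProperFilter F -> cauchy F -> cvg F;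
  cmul : A -> A -> A;
  cone : A;
  cmulA : associative cmul;
  cmul1 : left_id cone cmul;
  cmulr1 : right_id cone cmul;
  cmulDl : left_distributive cmul +%R;
  cmulDr : right_distributive cmul +%R;
  cscale : R[i] -> A -> A;
  cscaleA : forall (c d : R[i]) (a : A), cscale c (cscale d a) = cscale (c * d) a;
  cscale1 : left_id 1 cscale;
  cscaleDr : right_distributive cscale +%R;
  cscaleDl : forall a : A, {morph cscale^~ a : c d / c + d};
  cscaleAl : forall (c : R[i]) (a b : A), cscale c (cmul a b) = cmul (cscale c a) b;
  cscaleAr : forall (c : R[i]) (a b : A), cscale c (cmul a b) = cmul a (cscale c b);
  star : A -> A;
  starD : {morph star : a b / a + b};
  starZ : forall (c : R[i]) (a : A), star (cscale c a) = cscale (conjc c) (star a);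
  starM : forall a b : A, star (cmul a b) = cmul (star b) (star a);
  starK : involutive star;
  cnormZ : forall (c : R[i]) (a : A), `|cscale c a| = complex.Re `|c| * `|a|;
  cnormM : forall a b : A, `|cmul a b| <= `|a| * `|b|;
  cnorm_starM : forall a : A, `|cmul (star a) a| = `|a| ^+ 2
}.

#[short(type="cstarAlgType")]
HB.structure Definition CstarAlgebra (R : realType) :=
  {A of PseudoMetricNormedZmod R A & isCstarAlgebra R A}.

Section CstarInstances.
Variables (R : realType) (A : cstarAlgType R).

#[non_forgetful_inheritance]
HB.instance Definition _ :=
  GRing.Zmodule_isPzRing.Build (CstarAlgebra.sort A)
    cmulA cmul1 cmulr1 cmulDl cmulDr.

#[non_forgetful_inheritance]
HB.instance Definition _ :=
  GRing.Zmodule_isLmodule.Build R[i] (CstarAlgebra.sort A)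
    cscaleA cscale1 cscaleDr cscaleDl.

End CstarInstances.

Section CstarOrder.
Context {R : realType} {A : cstarAlgType R}.

Definition cpos (a : A) : Prop := exists b : A, a = star b * b.

Definition cle (a b : A) : Prop := cpos (b - a).

End CstarOrder.

(* Left Hilbert A-modules.  The inner product is definite by hnormE. *)
HB.mixin Record isHilbertModule (R : realType) (A : cstarAlgType R) H
    of PseudoMetricNormedZmod R H := {
  hilbert_complete : forall F : set_system H, ProperFilter F -> cauchy F -> cvg F;
  hact : A -> H -> H;
  hactA : forall (a b : A) (f : H), hact a (hact b f) = hact (a * b) f;
  hact1 : left_id (1 : A) hact;
  hactDr : right_distributive hact +%R;
  hactDl : forall f : H, {morph hact^~ f : a b / a + b};
  inner : H -> H -> A;
  innerDl : forall f g h : H, inner (f + g) h = inner f h + inner g h;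
  innerZl : forall (a : A) (f g : H), inner (hact a f) g = a * inner f g;
  inner_star : forall f g : H, star (inner f g) = inner g f;
  inner_pos : forall f : H, cpos (inner f f);
  hnormE : forall f : H, `|f| = Num.sqrt `|inner f f|
}.

#[short(type="hilbertModType")]
HB.structure Definition HilbertModule (R : realType) (A : cstarAlgType R) :=
  {H of PseudoMetricNormedZmod R H & isHilbertModule R A H}.

Section HilbertModuleInstances.
Variables (R : realType) (A : cstarAlgType R) (H : hilbertModType A).

#[non_forgetful_inheritance]
HB.instance Definition _ :=
  GRing.Zmodule_isLmodule.Build A (HilbertModule.sort H)
    hactA hact1 hactDr hactDl.

End HilbertModuleInstances.

Section UnorderedSums.
Context {R : realType} {J : choiceType}.

(* Norm convergence of the net of finite partial sums. *)
Definition usummable {V : pseudoMetricNormedZmodType R} (x : J -> V) : Prop :=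
  cvg (partial_sum x @ totally).

Definition usum {V : pseudoMetricNormedZmodType R} (x : J -> V) : V :=
  lim (partial_sum x @ totally).

(* The inequality sum_j x j <= b, without requiring the sum to converge in
   norm: the distance from the partial sums to {a | a <= b} tends to 0.
   If x is summable in norm this says usum x <= b.  If all the x j are positive
   it says that every finite partial sum is <= b, i.e. that the supremum of the
   partial sums in the enveloping von Neumann algebra is <= b. *)
Definition usum_le {A : cstarAlgType R} (x : J -> A) (b : A) : Prop :=
  forall e : R, 0 < e ->
    \forall F \near totally, exists2 a : A, cle a b & `|partial_sum x F - a| < e.

End UnorderedSums.

Section Operators.
Context {R : realType} {A : cstarAlgType R} {H : hilbertModType A}.

Definition closed_submodule (K : set H) : Prop :=
  [/\ closed K, K 0
    & forall (a : A) (f g : H), K f -> K g -> K (a *: f + g)].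

(* The action of the complex scalars on H. *)
Definition hscale (c : R[i]) (f : H) : H := (c *: (1 : A)) *: f.

Definition clinear (T : H -> H) : Prop :=
  forall (c : R[i]) (f g : H), T (hscale c f + g) = hscale c (T f) + T g.

Definition bounded_op (T : H -> H) : Prop :=
  exists M : R, forall f : H, `|T f| <= M * `|f|.

Definition positive_op (T : H -> H) : Prop :=
  forall f : H, cpos (inner (T f) f).

Definition GLpos (T : H -> H) : Prop :=
  [/\ clinear T, bounded_op T, positive_op T
    & exists T' : H -> H, [/\ cancel T T', cancel T' T & bounded_op T']].

Definition op_sqrt (T : H -> H) : H -> H :=
  get [set S : H -> H |
    [/\ clinear S, bounded_op S, positive_op S & S \o S = T]].

(* K is viewed as a Hilbert module in its own right, so the adjoint is only
   specified on K. *)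
Definition adjointable_into (K : set H) (L : H -> H) : Prop :=
  [/\ linear L, forall f : H, K (L f)
    & exists Ls : H -> H,
        forall f g : H, K g -> inner (L f) g = inner f (Ls g)].

(* Meaningful at the g in K when adjointable_into K L holds. *)
Definition adjoint (L : H -> H) (g : H) : H :=
  get [set h : H | forall f : H, inner (L f) g = inner f h].

End Operators.

Section Controlled.
Context {R : realType} {A : cstarAlgType R} {H : hilbertModType A}
  {J : choiceType}.
Implicit Types (K : J -> set H) (L : J -> H -> H).

Definition l2 K : set (J -> H) :=
  [set g | (forall j, K j (g j)) /\ usummable (fun j => inner (g j) (g j))].

Definition l2_inner (f g : J -> H) : A := usum (fun j => inner (f j) (g j)).

Definition l2_norm (g : J -> H) : R := Num.sqrt `|l2_inner g g|.

Definition l2_bounded_operator K (T : (J -> H) -> H) : Prop :=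
  (forall (a : A) (g h : J -> H), l2 K g -> l2 K h ->
     T (fun j => a *: g j + h j) = a *: T g + T h) /\
  (exists M : R, forall g : J -> H, l2 K g -> `|T g| <= M * l2_norm g).

Definition l2_opnorm K (T : (J -> H) -> H) : R :=
  sup [set `|T g| | g in [set g : J -> H | l2 K g /\ l2_norm g <= 1]].

Definition controlled_gBessel (C C' : H -> H) L (B : R) : Prop :=
  0 < B /\
  forall f : H,
    usum_le (fun j => inner (L j (C f)) (L j (C' f))) (B%:C%C *: inner f f).

Definition synthesis_term (C C' : H -> H) L (g : J -> H) (j : J) : H :=
  op_sqrt (C \o C') (adjoint (L j) (g j)).

Definition synthesis (C C' : H -> H) L (g : J -> H) : H :=
  usum (synthesis_term C C' L g).

Definition synthesis_well_defined K (C C' : H -> H) L : Prop :=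
  forall g : J -> H, l2 K g -> usummable (synthesis_term C C' L g).

End Controlled.

(* Main.v *)
(* Write S = (C C')^(1/2).  Since C C' is the product of commuting positive
   operators, S exists, and it commutes with everything that commutes with C and
   C'; hence <L_j C f, L_j C' f> = <L_j S f, L_j S f>.  The Bessel condition then
   says that every finite sum of the <L_j S f, L_j S f> is at most B <f, f>, and
   the synthesis operator has terms S L_j^* g_j.  One direction is the
   Cauchy-Schwarz inequality for finite families.  For the other one, the finite
   sums Q of the S L_j^* L_j S are self-adjoint and satisfy
   |Q f|^2 <= B |<Q f, f>| <= B |Q f| |f|, so |Q| <= B, and the norm bound becomes
   the order bound Q <= B in the C*-algebra of adjointable operators.

   No spectral theory is used.  Square roots come from the iteration
   y -> (x + y^2) / 2, which converges when |x| <= 1 because it is dominated by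
   the same scalar iteration at x = 1; this alone gives that the positive
   elements form a closed cone and, by an argument of Kaplansky, that every b^* b
   is positive.  The theory is applied both to A and to the operators on H. *)
Require Import Defs.
From HB Require Import structures.
From mathcomp Require Import all_boot all_order all_algebra.
From mathcomp Require Import complex finmap.
From mathcomp Require Import all_classical all_reals all_analysis.
From mathcomp Require Import ring lra.
From mathcomp.analysis.showcase Require Import summability.
Import Order.TTheory GRing.Theory Num.Theory.
Import numFieldNormedType.Exports.
Set Implicit Arguments.
Unset Strict Implicit.
Unset Printing Implicit Defensive.
Local Open Scope classical_set_scope.
Local Open Scope ring_scope.

(** * Identities in Z-modules *)

(* Rings here are not commutative, so [ring] does not apply: products are
   expanded by rewriting and the resulting Z-linear identity between monomials
   is checked by comparing coefficients. *)
Inductive zmod_expr :=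
  | ZAtom of nat | ZAdd of zmod_expr & zmod_expr | ZOpp of zmod_expr | ZZero.

Fixpoint zmod_eval (V : zmodType) (env : seq V) (e : zmod_expr) : V :=
  match e with
  | ZAtom n => nth 0 env n
  | ZAdd e1 e2 => zmod_eval env e1 + zmod_eval env e2
  | ZOpp e1 => - zmod_eval env e1
  | ZZero => 0
  end.

Fixpoint zmod_coef (e : zmod_expr) (k : nat) : int :=
  match e with
  | ZAtom n => (n == k)%:Z
  | ZAdd e1 e2 => zmod_coef e1 k + zmod_coef e2 k
  | ZOpp e1 => - zmod_coef e1 k
  | ZZero => 0
  end.

Lemma zmod_evalE (V : zmodType) (env : seq V) e :
  zmod_eval env e = \sum_(k < size env) env`_k *~ zmod_coef e k.
Proof.
elim: e => [n|e1 ih1 e2 ih2|e ih|] /=.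
- have [nlt|nge] := ltnP n (size env).
    rewrite (bigD1 (Ordinal nlt))//= eqxx mulr1z big1 ?addr0// => i.
    rewrite -val_eqE /= eq_sym => /negPf ->; exact: mulr0z.
  rewrite nth_default// big1// => i _.
  by rewrite gtn_eqF ?mulr0z// (leq_trans _ nge).
- by rewrite ih1 ih2 -big_split; apply: eq_bigr => i _; rewrite mulrzDr.
- by rewrite ih -sumrN; apply: eq_bigr => i _; rewrite mulrNz.
- by rewrite big1// => i _; rewrite mulr0z.
Qed.

Lemma zmod_eval_eq (V : zmodType) (env : seq V) e1 e2 :
  all (fun k => zmod_coef e1 k == zmod_coef e2 k) (iota 0 (size env)) ->
  zmod_eval env e1 = zmod_eval env e2.
Proof.
move=> /allP h; rewrite !zmod_evalE; apply: eq_bigr => k _.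
by rewrite (eqP (h k _))// mem_iota/=.
Qed.

(** Atoms are compared by [unify], so convertible terms get the same index. The tactic fails on the
    empty list, which is how [zmod_atoms] recognises a new atom. *)
Ltac zmod_atom env t :=
  lazymatch env with
  | ?x :: ?env' => match goal with
      | _ => let _ := match goal with _ => unify x t end in constr:(0%N)
      | _ => let n := zmod_atom env' t in constr:(n.+1)
      end
  end.

Ltac zmod_atoms V env t :=
  lazymatch t with
  | @Algebra.add _ ?a ?b =>
      let env' := zmod_atoms V env a in zmod_atoms V env' b
  | @Algebra.opp _ ?a => zmod_atoms V env a
  | @Algebra.zero _ => env
  | _ => match goal with
      | _ => let _ := zmod_atom env t in env
      | _ => constr:(@cons V t env)
      end
  end.

Ltac zmod_reify env t :=
  lazymatch t with
  | @Algebra.add _ ?a ?b =>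
      let a' := zmod_reify env a in let b' := zmod_reify env b in
      constr:(ZAdd a' b')
  | @Algebra.opp _ ?a => let a' := zmod_reify env a in constr:(ZOpp a')
  | @Algebra.zero _ => constr:(ZZero)
  | _ => let n := zmod_atom env t in constr:(ZAtom n)
  end.

Ltac zmod_solve :=
  lazymatch goal with
  | |- @eq ?T ?a ?b =>
      let V := constr:((T : Type) : zmodType) in
      let env0 := constr:(@nil T) in
      let env1 := zmod_atoms T env0 a in
      let env := zmod_atoms T env1 b in
      let ea := zmod_reify env a in
      let eb := zmod_reify env b in
      exact (@zmod_eval_eq _ env ea eb isT)
  end.

Ltac ncring :=
  rewrite ?(mulrDl, mulrDr, mulrN, mulNr, mulrA, mul1r, mulr1, mulr0, mul0r);
  zmod_solve.

(** * Positivity in C*-algebras *)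

Definition norm_closed (R : realType) (V : pseudoMetricNormedZmodType R)
    (Q : V -> Prop) : Prop :=
  forall x, (forall e : R, 0 < e -> exists2 y, Q y & `|x - y| < e) -> Q x.

Lemma ler_add_eps (R : realType) (x y k : R) :
  0 <= k -> (forall e, 0 < e -> x <= y + k * e) -> x <= y.
Proof.
move=> k0 h; apply/ler_addgt0Pr => e e0.
have := h (e / (k + 1)); rewrite divr_gt0 ?ltr_wpDl// => /(_ isT).
move=> /le_trans; apply.
rewrite lerD2l mulrCA ger_pMr// ler_pdivrMr ?ltr_wpDl// mul1r; lra.
Qed.

Lemma norm_eq0_eps (R : realType) (V : normedZmodType R) (x : V) (k : R) :
  0 <= k -> (forall e, 0 < e -> `|x| <= k * e) -> x = 0.
Proof.
move=> k0 h; apply/eqP; rewrite -normr_le0.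
by apply: (ler_add_eps k0) => e e0; rewrite add0r h.
Qed.

Section CstarRing.
Variables (R : realType) (A : cstarAlgType R).
Implicit Types (a b c x y : A) (s t : R).

Lemma cscalerAl (k : R[i]) a b : (k *: a) * b = k *: (a * b).
Proof. by rewrite -[RHS]/(Defs.cscale k (cmul a b)) cscaleAl. Qed.

Lemma cscalerAr (k : R[i]) a b : a * (k *: b) = k *: (a * b).
Proof. by rewrite -[RHS]/(Defs.cscale k (cmul a b)) cscaleAr. Qed.

Lemma star_mul a b : star (a * b) = star b * star a.
Proof. exact: starM. Qed.

Lemma star_scale (k : R[i]) a : star (k *: a) = conjc k *: star a.
Proof. exact: starZ. Qed.

Lemma star_scaler t a : star (t%:C%C *: a) = t%:C%C *: star a.
Proof. by rewrite star_scale conjc_real. Qed.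

Lemma star0 : star (0 : A) = 0.
Proof. by apply: (@addrI _ (star 0)); rewrite -starD !addr0. Qed.

Lemma starN a : star (- a) = - star a.
Proof. by apply: (@addrI _ (star a)); rewrite -starD !subrr star0. Qed.

Lemma starB a b : star (a - b) = star a - star b.
Proof. by rewrite starD starN. Qed.

Lemma star1 : star (1 : A) = 1.
Proof.
by have := star_mul (star 1) (1 : A); rewrite mulr1 starK mulr1 => <-.
Qed.

Lemma norm_mul a b : `|a * b| <= `|a| * `|b|.
Proof. exact: cnormM. Qed.

Lemma norm_star_mul a : `|star a * a| = `|a| ^+ 2.
Proof. exact: cnorm_starM. Qed.

Lemma norm_scaler t a : `|t%:C%C *: a| = `|t| * `|a|.
Proof.
rewrite -[_ *: a]/(Defs.cscale _ a) cnormZ normc_def /= expr0n /= addr0.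
by rewrite sqrtr_sqr.
Qed.

Lemma norm_scalei a : `|'i%C *: a| = `|a|.
Proof.
rewrite -[_ *: a]/(Defs.cscale _ a) cnormZ normc_def /= expr0n /= add0r.
by rewrite expr1n sqrtr1 mul1r.
Qed.

(** From |b|^2 = |star b * b| <= |star b| |b| one cancels |b|; applying this to [a] and to [star a]
    gives both inequalities. *)
Lemma norm_star a : `|star a| = `|a|.
Proof.
have le b : `|b| <= `|star b|.
  have [->|b0] := eqVneq b 0; first by rewrite star0.
  rewrite -(@ler_pM2r _ `|b|) ?normr_gt0// -expr2 -norm_star_mul.
  exact: norm_mul.
by apply/eqP; rewrite eq_le le -{2}(starK a) le.
Qed.

(** The norm of 1 is idempotent, hence 0 or 1; the value 0 occurs in the zero algebra. *)
Lemma norm1_le1 : `|1 : A| <= 1.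
Proof.
have := norm_star_mul 1; rewrite star1 mulr1 => h.
have [->//|n0] := eqVneq `|1 : A| 0.
suff -> : `|1 : A| = 1 by [].
by apply: (mulfI n0); rewrite mulr1 -expr2 -h.
Qed.

Lemma norm_sqr a : star a = a -> `|a * a| = `|a| ^+ 2.
Proof. by move=> sa; rewrite -{1}sa norm_star_mul. Qed.

Lemma star_mul_eq0 a : star a * a = 0 -> a = 0.
Proof.
move=> h; apply/eqP; rewrite -normr_eq0 -sqrf_eq0 -norm_star_mul h.
by rewrite normr0.
Qed.

Lemma sqr_eq0 a : star a = a -> a * a = 0 -> a = 0.
Proof. by move=> sa h; apply: star_mul_eq0; rewrite sa. Qed.

(** Then a^4 = 0, and a self-adjoint element with zero square vanishes: this is used for a^2, then
    for a. *)
Lemma cube_eq0 a : star a = a -> a * a * a = 0 -> a = 0.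
Proof.
move=> sa h; apply: sqr_eq0 => //; apply: sqr_eq0; first by rewrite star_mul sa.
by rewrite mulrA h mul0r.
Qed.

(* Closure under squares rather than products lets the self-adjoint elements
   qualify; it is all that the square root iteration needs. *)
Record closed_calculus (Q : A -> Prop) : Prop := ClosedCalculus {
  calculus1 : Q 1;
  calculusZ : forall t x, Q x -> Q (t%:C%C *: x);
  calculusD : forall x y, Q x -> Q y -> Q (x + y);
  calculus_sqr : forall x, Q x -> Q (x * x);
  calculus_closed : norm_closed Q }.

Lemma calculusB Q (cQ : closed_calculus Q) x y : Q x -> Q y -> Q (x - y).
Proof.
move=> Qx Qy; rewrite -scaleN1r; apply: (calculusD cQ) => //.
have -> : (-1 : R[i]) = (-1)%:C%C by rewrite rmorphN rmorph1.
exact: calculusZ.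
Qed.

Lemma calculus_sa : closed_calculus (fun x => star x = x).
Proof.
split=> [|t x h|x y hx hy|x h|x h].
- exact: star1.
- by rewrite star_scaler h.
- by rewrite starD hx hy.
- by rewrite star_mul h.
apply/eqP; rewrite -subr_eq0; apply/eqP/(@norm_eq0_eps _ _ _ 2) => // e e0.
have [y sy xy] := h e e0.
have -> : star x - x = star (x - y) + (y - x).
  by rewrite starB sy addrA subrK.
by rewrite (le_trans (ler_normD _ _))// norm_star (distrC y); lra.
Qed.

Lemma calculus_comm c : closed_calculus (fun x => x * c = c * x).
Proof.
split=> [|t x h|x y hx hy|x h|x h].
- by rewrite mul1r mulr1.
- by rewrite cscalerAl cscalerAr h.
- by rewrite mulrDl mulrDr hx hy.
- by rewrite -mulrA h !mulrA h.
apply/eqP; rewrite -subr_eq0; apply/eqP/(@norm_eq0_eps _ _ _ (2 * `|c|)).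
  by rewrite mulr_ge0.
move=> e e0; have [y sy xy] := h e e0.
have -> : x * c - c * x = (x - y) * c + c * (y - x).
  by rewrite mulrBl mulrBr sy addrA subrK.
rewrite (le_trans (ler_normD _ _))//.
rewrite (le_trans (lerD (norm_mul _ _) (norm_mul _ _)))//.
rewrite (distrC y) (mulrC `|c|) -mulrDl mulrAC; apply: ler_wpM2r => //; lra.
Qed.

End CstarRing.

(** * Square roots of 1 - x by a majorised iteration *)

Section SquareRoot.
Variables (R : realType) (A : cstarAlgType R).
Implicit Types (a b c x y : A) (s t : R).

Fixpoint sqrt_majorant (n : nat) : R :=
  if n is m.+1 then 2^-1 * (1 + sqrt_majorant m ^+ 2) else 0.

(** A fixed point y satisfies 2 y = x + y^2, that is (1 - y)^2 = 1 - x. *)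
Fixpoint sqrt_iter x (n : nat) : A :=
  if n is m.+1 then (2^-1)%:C%C *: (x + sqrt_iter x m * sqrt_iter x m) else 0.

Lemma sqrt_majorant_itv n : 0 <= sqrt_majorant n <= 1.
Proof. by elim: n => [|n /andP[h0 h1]] /=; nra. Qed.

Lemma sqrt_majorantS n : sqrt_majorant n <= sqrt_majorant n.+1.
Proof.
elim: n => [|n ih] /=; first lra.
have /andP[h0 h1] := sqrt_majorant_itv n.
rewrite ler_pM2l ?invr_gt0// lerD2l lerXn2r ?nnegrE//.
exact: le_trans ih.
Qed.

Lemma sqrt_iter_le x n : `|x| <= 1 -> `|sqrt_iter x n| <= sqrt_majorant n.
Proof.
move=> x1; elim: n => [|n ih] /=; first by rewrite normr0.
rewrite norm_scaler ger0_norm ?invr_ge0// ler_pM2l ?invr_gt0//.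
rewrite (le_trans (ler_normD _ _))// lerD// (le_trans (norm_mul _ _))//.
by rewrite expr2 ler_pM.
Qed.

(** Without commutativity, u^2 - v^2 = u (u - v) + (u - v) v. The increment of the majorant factors
    in the same way, so the bound propagates factor by factor. *)
Lemma sqrt_iterS x n : `|x| <= 1 ->
  `|sqrt_iter x n.+1 - sqrt_iter x n| <= sqrt_majorant n.+1 - sqrt_majorant n.
Proof.
move=> x1; elim: n => [|n ih].
  rewrite /= subr0 mulr0 addr0 norm_scaler ger0_norm ?invr_ge0//; lra.
have e (u v : A) : (2^-1)%:C%C *: (x + u * u) - (2^-1)%:C%C *: (x + v * v) =
  (2^-1)%:C%C *: (u * (u - v) + (u - v) * v).
  by rewrite -scalerBr; congr (_ *: _); ncring.
rewrite -/(sqrt_iter x n.+1) -/(sqrt_majorant n.+1) in ih *.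
set u := sqrt_iter x n.+1 in ih *; set v := sqrt_iter x n in ih *.
have -> : sqrt_iter x n.+2 = (2^-1)%:C%C *: (x + u * u) by [].
have {2}-> : u = (2^-1)%:C%C *: (x + v * v) by [].
have -> : sqrt_majorant n.+2 = 2^-1 * (1 + sqrt_majorant n.+1 ^+ 2) by [].
have {2}-> : sqrt_majorant n.+1 = 2^-1 * (1 + sqrt_majorant n ^+ 2) by [].
rewrite e -mulrBr norm_scaler ger0_norm ?invr_ge0// ler_pM2l ?invr_gt0//.
set m1 := sqrt_majorant n.+1; set m0 := sqrt_majorant n.
have -> : 1 + m1 ^+ 2 - (1 + m0 ^+ 2) = m1 * (m1 - m0) + (m1 - m0) * m0 by ring.
by rewrite (le_trans (ler_normD _ _))// lerD// (le_trans (norm_mul _ _))// ler_pM//;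
  apply: sqrt_iter_le.
Qed.

Lemma sqrt_iter_cauchy x n m : `|x| <= 1 -> (n <= m)%N ->
  `|sqrt_iter x m - sqrt_iter x n| <= sqrt_majorant m - sqrt_majorant n.
Proof.
move=> x1 /subnKC <-; elim: (m - n)%N => [|k ih].
  by rewrite addn0 !subrr normr0.
rewrite addnS.
rewrite -(subrK (sqrt_iter x (n + k)) (sqrt_iter x (n + k).+1)) -addrA.
rewrite (le_trans (ler_normD _ _))// (le_trans (lerD (sqrt_iterS _ x1) ih))//.
by rewrite addrA subrK.
Qed.

(** Two consecutive iterates are controlled at once because the recursion relates one to the next,
    and it is the recursion that has to pass to the limit. *)
Lemma sqrt_iter_cvg x : `|x| <= 1 ->
  exists2 y : A, `|y| <= 1 &
    forall e, 0 < e -> exists2 n, `|y - sqrt_iter x n| < e &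
                                  `|y - sqrt_iter x n.+1| < e.
Proof.
move=> x1.
have mono : {homo sqrt_majorant : n m / (n <= m)%N >-> n <= m}.
  by apply/nondecreasing_seqP => n; exact: sqrt_majorantS.
have cm : cvgn sqrt_majorant.
  apply: nondecreasing_is_cvgn => //; exists 1 => _ [n _ <-].
  by case/andP: (sqrt_majorant_itv n).
have : cvg (sqrt_iter x @ \oo).
  apply: cstar_complete; apply: cauchy_exP => e e0.
  have /cvgr_dist_lt/(_ _ e0)[n _ hn] := cm.
  exists (sqrt_iter x n), n => // m /= nm.
  rewrite -ball_normE/= distrC (le_lt_trans (sqrt_iter_cauchy x1 nm))//.
  have := hn n (leqnn n); have := nondecreasing_cvgn_le mono cm m.
  have := nondecreasing_cvgn_le mono cm n => /= h1 h2.
  rewrite ger0_norm ?subr_ge0//; lra.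
move=> /cvg_ex[y hy]; exists y; last first.
  move=> e e0; have /cvgr_dist_lt/(_ _ e0)[n _ hn] := hy.
  by exists n; apply: hn => /=.
apply: (@ler_add_eps _ _ _ 1) => // e e0; have /cvgr_dist_lt/(_ _ e0)[n _ hn] := hy.
have := hn n (leqnn n) => /= h.
have /andP[_ m1] := sqrt_majorant_itv n; have := sqrt_iter_le n x1.
have := ler_normD (y - sqrt_iter x n) (sqrt_iter x n); rewrite subrK; lra.
Qed.

(** The last clause holds because y is a norm limit of iterates built from x by operations that
    preserve Q. Self-adjointness and commutation relations are transferred to roots in this way. *)
Lemma sqrt_one_minus x : `|x| <= 1 ->
  exists y, [/\ `|y| <= 1, (1 - y) * (1 - y) = 1 - x &
    forall Q, closed_calculus Q -> Q x -> Q y].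
Proof.
move=> x1; have [y y1 hy] := sqrt_iter_cvg x1; exists y; split=> //.
- suff yE : y + y = x + y * y.
    have -> : (1 - y) * (1 - y) = 1 - (y + y) + y * y by ncring.
    by rewrite yE; zmod_solve.
  (* The error consists of two copies of y - v and two products of y - u with a factor of norm at
     most 1, whence the constant 4. *)
  apply/eqP; rewrite -subr_eq0; apply/eqP/(@norm_eq0_eps _ _ _ 4) => // e e0.
  have [n h0 h1] := hy e e0; set u := sqrt_iter x n in h0.
  set v := sqrt_iter x n.+1 in h1.
  have vE : v + v = x + u * u.
    rewrite /v /= -scalerDl -rmorphD /=.
    have -> : 2^-1 + 2^-1 = 1 :> R by lra.
    by rewrite rmorph1 scale1r.
  have -> : y + y - (x + y * y) =
      (y - v) + (y - v) - ((y - u) * y + u * (y - u)).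
    have -> : y - v + (y - v) = y + y - (v + v) by zmod_solve.
    by rewrite vE; ncring.
  have u1 : `|u| <= 1.
    apply: (le_trans (sqrt_iter_le n x1)).
    by case/andP: (sqrt_majorant_itv n).
  rewrite (le_trans (ler_normB _ _))//.
  have := ler_normD (y - v) (y - v).
  have := ler_normD ((y - u) * y) (u * (y - u)).
  have := norm_mul (y - u) y; have := norm_mul u (y - u).
  have : `|u| * `|y - u| <= `|y - u| by rewrite ler_piMl.
  have : `|y - u| * `|y| <= `|y - u| by rewrite ler_piMr.
  lra.
- move=> Q cQ Qx; apply: (calculus_closed cQ) => e e0.
  have [n h _] := hy e e0; exists (sqrt_iter x n) => //.
  elim: n {h} => [|n ih] /=.
    by rewrite -(subrr (1 : A)); apply: (calculusB cQ); exact: (calculus1 cQ).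
  apply: (calculusZ cQ); apply: (calculusD cQ) => //; exact: (calculus_sqr cQ).
Qed.
End SquareRoot.

(* A self-adjoint element is positive iff its distance to some scalar [t] is at
   most [t]: this form makes the positive elements visibly a convex cone. *)
Definition norm_pos (R : realType) (A : cstarAlgType R) (a : A) : Prop :=
  star a = a /\ exists t : R, `|t%:C%C *: (1 : A) - a| <= t.

(** * The cone of positive elements and the positivity of [star b * b] *)

Section Positivity.
Variables (R : realType) (A : cstarAlgType R).
Implicit Types (a b c h k x y : A) (s t : R).

Lemma scalerCA s a b : (s%:C%C *: a) * (s%:C%C *: b) = (s * s)%:C%C *: (a * b).
Proof. by rewrite cscalerAl cscalerAr scalerA rmorphM. Qed.

Lemma scaler_inv s a : s != 0 -> s%:C%C *: (s^-1%:C%C *: a) = a.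
Proof. by move=> s0; rewrite scalerA -rmorphM /= mulfV// rmorph1 scale1r. Qed.

(** With x = 1 - a / t one has |x| <= 1. If (1 - y)^2 = 1 - x, then b = sqrt t (1 - y) squares to a,
    and it lies within sqrt t of the scalar sqrt t. *)
Lemma norm_pos_sqrt a : norm_pos a ->
  exists b, [/\ norm_pos b, b * b = a &
    forall Q, closed_calculus Q -> Q a -> Q b].
Proof.
case=> sa [t ht].
(* The given t may be 0; passing to t + 1 allows division. *)
have t1 : 0 < t + 1 by rewrite ltr_wpDl// (le_trans _ ht).
have ht1 : `|(t + 1)%:C%C *: (1 : A) - a| <= t + 1.
  have -> : (t + 1)%:C%C *: (1 : A) - a = (t%:C%C *: (1 : A) - a) + 1.
    by rewrite rmorphD scalerDl rmorph1 scale1r; zmod_solve.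
  by rewrite (le_trans (ler_normD _ _))// lerD// norm1_le1.
move: (t + 1) t1 ht1 => {ht}t t0 ht.
pose x := 1 - t^-1%:C%C *: a.
have tx : t%:C%C *: x = t%:C%C *: (1 : A) - a.
  by rewrite /x scalerBr scaler_inv// gt_eqF.
have x1 : `|x| <= 1.
  by rewrite -(@ler_pM2l _ t)// -[X in X * _]gtr0_norm// -norm_scaler tx mulr1.
have [y [y1 yE yQ]] := sqrt_one_minus x1.
have st : Num.sqrt t * Num.sqrt t = t by rewrite -expr2 sqr_sqrtr// ltW.
have bQ Q : closed_calculus Q -> Q a -> Q ((Num.sqrt t)%:C%C *: (1 - y)).
  move=> cQ Qa; apply: (calculusZ cQ); apply: (calculusB cQ).
    exact: (calculus1 cQ).
  apply: yQ => //; apply: (calculusB cQ); first exact: (calculus1 cQ).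
  exact: (calculusZ cQ).
exists ((Num.sqrt t)%:C%C *: (1 - y)); split=> //.
- split; first exact: (bQ _ (calculus_sa A)).
  exists (Num.sqrt t); rewrite scalerBr opprB addrC subrK norm_scaler.
  by rewrite ger0_norm ?sqrtr_ge0// ler_piMr// sqrtr_ge0.
rewrite scalerCA st yE /x opprB addrC subrK scaler_inv// gt_eqF//.
Qed.

(* [h + i k] is unitary. *)
Lemma circle_norm_le1 h k : star h = h -> star k = k -> h * k = k * h ->
  h * h + k * k = 1 -> `|h| <= 1.
Proof.
move=> sh sk hk hk1; pose u := h + 'i%C *: k.
have ii (z : A) : 'i%C *: ('i%C *: z) = - z.
  by rewrite scalerA -expr2 sqr_i scaleN1r.
have su : star u = h - 'i%C *: k.
  rewrite starD star_scale sh sk; congr (_ + _); rewrite -scaleNr.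
  by congr (_ *: _); apply/eqP; rewrite eq_complex/= oppr0 !eqxx.
have u1 : `|u| <= 1.
  suff : `|u| ^+ 2 <= 1 by rewrite expr_le1.
  rewrite -norm_star_mul su.
  suff -> : (h - 'i%C *: k) * u = 1 by exact: norm1_le1.
  rewrite /u mulrDr !mulrBl !cscalerAl !cscalerAr ii -hk -hk1.
  by zmod_solve.
have uu : h + h = u + star u by rewrite su /u; zmod_solve.
have : `|h + h| <= 2.
  rewrite uu (le_trans (ler_normD _ _))// norm_star; lra.
have -> : h + h = 2%:C%C *: h.
  by rewrite (_ : 2 = 1 + 1)// rmorphD rmorph1 scalerDl scale1r.
by rewrite norm_scaler ger0_norm//; lra.
Qed.

(** The root k = 1 - y of 1 - h^2 commutes with h and h^2 + k^2 = 1, so |k| <= 1. *)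
Lemma one_minus_sqr_le1 h : star h = h -> `|h| <= 1 -> `|1 - h * h| <= 1.
Proof.
move=> sh h1.
have hh1 : `|h * h| <= 1 by rewrite norm_sqr// expr_le1.
have [y [y1 yE yQ]] := sqrt_one_minus hh1.
have sy : star y = y by apply: (yQ _ (calculus_sa A)); rewrite star_mul sh.
have yh : y * h = h * y by apply: (yQ _ (calculus_comm h)); rewrite mulrA.
have sy1 : star (1 - y) = 1 - y by rewrite starB star1 sy.
rewrite -yE norm_sqr// expr_le1//; apply: (@circle_norm_le1 _ h) => //.
  by rewrite mulrBl mulrBr yh mul1r mulr1.
by rewrite yE subrK.
Qed.

Lemma sqr_dist_le h t : star h = h -> 0 < t -> `|h| ^+ 2 <= t ->
  `|t%:C%C *: (1 : A) - h * h| <= t.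
Proof.
move=> sh t0 ht; have s0 : 0 < Num.sqrt t by rewrite sqrtr_gt0.
pose g := (Num.sqrt t)^-1%:C%C *: h.
have hg : h = (Num.sqrt t)%:C%C *: g by rewrite scaler_inv// gt_eqF.
have g1 : `|g| <= 1.
  rewrite -(@ler_pM2l _ (Num.sqrt t))// -[X in X * _]gtr0_norm// -norm_scaler.
  by rewrite -hg mulr1 -(@ler_sqr _ `|h|) ?nnegrE// ?sqr_sqrtr// ltW.
rewrite hg scalerCA -expr2 sqr_sqrtr ?(ltW t0)// -scalerBr norm_scaler gtr0_norm//.
rewrite ger_pMr// one_minus_sqr_le1//.
by rewrite star_scaler sh.
Qed.

Lemma norm_pos_sqr h : star h = h -> norm_pos (h * h).
Proof.
move=> sh; split; first by rewrite star_mul sh.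
exists (`|h| ^+ 2 + 1); by apply: sqr_dist_le => //; rewrite ?lerDl// ltr_wpDl// sqr_ge0.
Qed.

Lemma norm_posD a b : norm_pos a -> norm_pos b -> norm_pos (a + b).
Proof.
move=> [sa [s hs]] [sb [t ht]]; split; first by rewrite starD sa sb.
exists (s + t); rewrite rmorphD scalerDl.
apply: le_trans (lerD hs ht); apply: le_trans (ler_normD _ _).
by rewrite le_eqVlt; apply/orP; left; apply/eqP; congr `|_|; zmod_solve.
Qed.

Lemma norm_posZ t a : 0 <= t -> norm_pos a -> norm_pos (t%:C%C *: a).
Proof.
move=> t0 [sa [s hs]]; split; first by rewrite star_scaler sa.
exists (t * s); rewrite rmorphM -scalerA -scalerBr norm_scaler ger0_norm//.
by rewrite ler_wpM2l.
Qed.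

(** Since a is a square, [sqr_dist_le] applies. The witness in [norm_pos] can thus be chosen from a
    norm bound alone, uniformly over a bounded set, which is what closedness of the cone
    requires. *)
Lemma norm_pos_dist a t : norm_pos a -> 0 < t -> `|a| <= t ->
  `|t%:C%C *: (1 : A) - a| <= t.
Proof.
move=> /norm_pos_sqrt[b [[sb _] <- _]] t0 ht; apply: sqr_dist_le => //.
by rewrite -norm_sqr.
Qed.

Lemma norm_pos_closed : norm_closed (@norm_pos R A).
Proof.
move=> a h; have sa : star a = a.
  apply: (calculus_closed (calculus_sa A)) => e e0.
  by have [b [sb _] ab] := h e e0; exists b.
split=> //; exists (`|a| + 1); apply: (@ler_add_eps _ _ _ 1) => // e e0.
(* The cap at 1 bounds every approximant by |a| + 1, so that one scalar serves for all of them. *)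
have e10 : 0 < Num.min e 1 by rewrite lt_min e0 ltr01.
have [b pb] := h _ e10; rewrite lt_min => /andP[abe ab1].
have b1 : `|b| <= `|a| + 1.
  have -> : b = a - (a - b) by zmod_solve.
  by rewrite (le_trans (ler_normB _ _))// lerD// ltW.
have a0 : 0 < `|a| + 1 by rewrite ltr_wpDl.
have := norm_pos_dist pb a0 b1.
set u := _ *: _; have -> : u - a = (u - b) + (b - a) by zmod_solve.
move=> ?; rewrite (le_trans (ler_normD _ _))// (distrC b); lra.
Qed.

Lemma sa_le_norm a t : star a = a -> `|a| <= t ->
  norm_pos (t%:C%C *: (1 : A) - a).
Proof.
move=> sa ht; split; first by rewrite starB star_scaler star1 sa.
by exists t; rewrite opprB addrC subrK.
Qed.

(** The roots h of x and k of 1 - x commute and satisfy h^2 + k^2 = 1, so [circle_norm_le1] bounds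
    h. *)
Lemma norm_pos_le1 x : norm_pos x -> norm_pos (1 - x) -> `|x| <= 1.
Proof.
move=> /norm_pos_sqrt[h [[sh _] hx hQ]] /norm_pos_sqrt[k [[sk _] kx kQ]].
rewrite -hx norm_sqr// expr_le1//.
apply: (circle_norm_le1 sh sk); last by rewrite hx kx addrC subrK.
apply/esym/(kQ _ (calculus_comm h)).
have xh : x * h = h * x by rewrite -hx mulrA.
by rewrite mulrBl mulrBr xh mul1r mulr1.
Qed.

(** Dividing by t = |b| + e reduces to [norm_pos_le1], since a <= b <= t; the e keeps t positive
    when b = 0. *)
Lemma norm_pos_le a b : norm_pos a -> norm_pos (b - a) -> `|a| <= `|b|.
Proof.
move=> pa pb; apply: (@ler_add_eps _ _ _ 1) => // e e0; rewrite mul1r.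
set t := `|b| + e; have t0 : 0 < t by rewrite ltr_wpDl.
have sb : star b = b.
  have -> : b = (b - a) + a by zmod_solve.
  by rewrite starD pa.1 pb.1.
have ta : norm_pos (t%:C%C *: (1 : A) - a).
  have -> : t%:C%C *: (1 : A) - a = (t%:C%C *: (1 : A) - b) + (b - a) by zmod_solve.
  by apply: norm_posD => //; apply: sa_le_norm => //; rewrite lerDl ltW.
have tI : 0 <= t^-1 by rewrite invr_ge0 ltW.
have := norm_pos_le1 (norm_posZ tI pa).
have -> : 1 - t^-1%:C%C *: a = t^-1%:C%C *: (t%:C%C *: (1 : A) - a).
  rewrite scalerBr; congr (_ - _).
  by rewrite scalerA -rmorphM /= mulVf ?gt_eqF// rmorph1 scale1r.
move=> /(_ (norm_posZ tI ta)); rewrite norm_scaler ger0_norm//.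
by rewrite ler_pdivrMl// mulr1.
Qed.

Lemma norm_pos_anti a : norm_pos a -> norm_pos (- a) -> a = 0.
Proof.
move=> pa pNa; apply/eqP; rewrite -normr_le0 -(normr0 A).
by apply: norm_pos_le => //; rewrite sub0r.
Qed.

(** Twice this element is the sum of the squares of the self-adjoint elements c + star c and i (c -
    star c). *)
Lemma norm_pos_sqr_sum c : norm_pos (star c * c + c * star c).
Proof.
have sx : star (c + star c) = c + star c by rewrite starD starK addrC.
have sy : star ('i%C *: (c - star c)) = 'i%C *: (c - star c).
  rewrite star_scale starB starK -opprB scalerN -scaleNr.
  by congr (_ *: _); apply/eqP; rewrite eq_complex/= oppr0 opprK !eqxx.
have := norm_posD (norm_pos_sqr sx) (norm_pos_sqr sy).
rewrite cscalerAl cscalerAr scalerA -(expr2 'i%C) sqr_i scaleN1r.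
have -> : (c + star c) * (c + star c) - (c - star c) * (c - star c) =
   (star c * c + c * star c) + (star c * c + c * star c) by ncring.
have h2 : 0 <= 2^-1 :> R by rewrite invr_ge0.
move=> /(norm_posZ h2); rewrite -[X in X + X]scale1r -scalerDl.
rewrite scalerA.
have -> : 2^-1%:C%C * (1 + 1) = 1 :> R[i].
  rewrite -(rmorph1 (real_complex R)) -rmorphD -rmorphM /=; congr (_%:C%C); lra.
by rewrite scale1r.
Qed.

(* If [c^* c = -q] then [p := c c^*] is positive, and [d := c q^(1/2)] has
   [d^* d + d d^* = -(q^2 + p^2)]. *)
Lemma neg_star_mul_eq0 c : norm_pos (- (star c * c)) -> c = 0.
Proof.
move=> pq; set q := - (star c * c) in pq.
have cq : star c * c = - q by rewrite opprK.
pose p := c * star c.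
have pp : norm_pos p.
  have -> : p = (star c * c + c * star c) + q by rewrite /p /q; zmod_solve.
  by apply: norm_posD => //; exact: norm_pos_sqr_sum.
have [w [[sw _] ww wQ]] := norm_pos_sqrt pq.
have := norm_pos_sqr_sum (c * w); rewrite star_mul sw.
have -> : w * star c * (c * w) = - (q * q).
  have -> : w * star c * (c * w) = w * (star c * c) * w by rewrite !mulrA.
  by rewrite cq -ww; ncring.
have -> : c * w * (w * star c) = - (p * p).
  have -> : c * w * (w * star c) = c * (w * w) * star c by rewrite !mulrA.
  by rewrite ww /q /p; ncring.
move=> h; have sp : star p = p by case: pp.
have p0 : p * p = 0.
  apply: norm_pos_anti; first exact: norm_pos_sqr.
  have -> : - (p * p) = - (q * q) - p * p + q * q by zmod_solve.
  by apply: norm_posD => //; apply: norm_pos_sqr; case: pq.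
have : star (star c) * star c = 0 by rewrite starK -/p; apply: sqr_eq0.
by move/star_mul_eq0 => c0; rewrite -(starK c) c0 star0.
Qed.

(* [u := |a| - a] plays the part of the negative part of [a], with
   [v = |a|^(1/2) u]. *)
Lemma negative_part a : star a = a ->
  exists u v, [/\ star u = u, star v = v, u * a * u = - (v * v) &
    v = 0 -> norm_pos a].
Proof.
move=> sa; have [r [pr rr rQ]] := norm_pos_sqrt (norm_pos_sqr sa).
have sr : star r = r by case: pr.
have ra : r * a = a * r by apply: (rQ _ (calculus_comm a)); rewrite mulrA.
have [w [[sw _] ww wQ]] := norm_pos_sqrt pr.
have wa : w * a = a * w by apply: (wQ _ (calculus_comm a)).
have wr : w * r = r * w by rewrite -ww mulrA.
pose t := r - a.
have st : star t = t by rewrite starB sr sa.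
have wt : w * t = t * w by rewrite mulrBr mulrBl wa wr.
have ta : t * a = - (t * r) by rewrite /t !mulrBl ra rr; zmod_solve.
have vv : (w * t) * (w * t) = t * r * t.
  by rewrite wt -mulrA -wt -ww !mulrA -!mulrA.
exists t, (w * t); split=> //.
- by rewrite star_mul sw st.
- by rewrite ta vv mulNr.
move=> v0; suff /eqP : t = 0 by rewrite subr_eq0 => /eqP <-.
(* Here t^2 = 2 t r and t r t = v^2 = 0, so t^3 = 0. *)
apply: cube_eq0 => //.
have -> : t * t = t * r + t * r.
  by rewrite {2}/t mulrBr ta opprK.
by rewrite mulrDl -vv v0 mulr0 addr0.
Qed.

(** Kaplansky's argument: with t and v from [negative_part], the element b t satisfies star (b t) *
    (b t) = - v^2, so b t = 0 by [neg_star_mul_eq0]. Then v = 0. *)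
Lemma norm_pos_star_mul b : norm_pos (star b * b).
Proof.
have sa : star (star b * b) = star b * b by rewrite star_mul starK.
have [t [v [st sv tat vP]]] := negative_part sa; apply: vP.
have btbt : star (b * t) * (b * t) = - (v * v).
  by rewrite -tat star_mul st !mulrA.
have bt0 : b * t = 0.
  by apply: neg_star_mul_eq0; rewrite btbt opprK; exact: norm_pos_sqr.
apply: sqr_eq0 => //; apply/eqP; rewrite -oppr_eq0 -btbt bt0.
by rewrite mulr0.
Qed.

Lemma norm_posE : @norm_pos R A = @cpos R A.
Proof.
apply/predeqP => a; split=> [/norm_pos_sqrt[b [[sb _] <- _]]|[b ->]].
  by exists b; rewrite sb.
exact: norm_pos_star_mul.
Qed.

End Positivity.

(** * The order on a C*-algebra: uniqueness of roots and an abstract Cauchy-Schwarz inequality *)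

Section PositiveCone.
Variables (R : realType) (A : cstarAlgType R).
Implicit Types (a b c h x y p q r : A) (s t : R).

Lemma cpos_sa a : cpos a -> star a = a.
Proof. by move=> [b ->]; rewrite star_mul starK. Qed.

Lemma cpos_star_mul b : cpos (star b * b). Proof. by exists b. Qed.

Lemma cpos_sqr h : star h = h -> cpos (h * h).
Proof. by move=> sh; exists h; rewrite sh. Qed.

Lemma cpos0 : cpos (0 : A).
Proof. by exists 0; rewrite mulr0. Qed.

Lemma cposD a b : cpos a -> cpos b -> cpos (a + b).
Proof. rewrite -norm_posE; exact: norm_posD. Qed.

Lemma cposZ t a : 0 <= t -> cpos a -> cpos (t%:C%C *: a).
Proof. rewrite -norm_posE; exact: norm_posZ. Qed.

Lemma cpos_closed : norm_closed (@cpos R A).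
Proof. rewrite -norm_posE; exact: norm_pos_closed. Qed.

Lemma cpos_anti a : cpos a -> cpos (- a) -> a = 0.
Proof. rewrite -norm_posE; exact: norm_pos_anti. Qed.

Lemma cpos_le a b : cpos a -> cpos (b - a) -> `|a| <= `|b|.
Proof. rewrite -norm_posE; exact: norm_pos_le. Qed.

Lemma cpos_norm_sub a t : star a = a -> `|a| <= t ->
  cpos (t%:C%C *: (1 : A) - a).
Proof. rewrite -norm_posE; exact: sa_le_norm. Qed.

Lemma cpos_conj a c : cpos a -> cpos (c * a * star c).
Proof.
by move=> [b ->]; exists (b * star c); rewrite star_mul starK !mulrA.
Qed.

Lemma cpos_sum (I : Type) (r : seq I) (P : pred I) (F : I -> A) :
  (forall i, P i -> cpos (F i)) -> cpos (\sum_(i <- r | P i) F i).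
Proof. by move=> h; elim/big_ind: _ => //; [exact: cpos0|exact: cposD]. Qed.

Lemma cpos_sqrt a : cpos a ->
  exists b, [/\ cpos b, b * b = a &
    forall Q, closed_calculus Q -> Q a -> Q b].
Proof. by rewrite -norm_posE => /norm_pos_sqrt. Qed.

(** This rests on uniqueness of positive roots. The constructed root b of a^2 commutes with a, so d
    = b - a satisfies d b d + d a d = d (b + a) d = 0. Both terms are positive, hence zero, and
    their difference is d^3. *)
Lemma cpos_sqrt_calculus a Q : cpos a -> closed_calculus Q ->
  Q (a * a) -> Q a.
Proof.
move=> pa cQ Qa; have sa := cpos_sa pa.
have [b [pb bb bQ]] := cpos_sqrt (cpos_sqr sa).
suff <- : b = a by exact: bQ.
have sb := cpos_sa pb.
have ba : b * a = a * b by apply: (bQ _ (calculus_comm a)); rewrite mulrA.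
set d := b - a; have sd : star d = d by rewrite starB sb sa.
have conjd x : cpos x -> cpos (d * x * d).
  by move=> /(cpos_conj d); rewrite sd.
have s0 : d * b * d + d * a * d = 0.
  rewrite -mulrDl -mulrDr.
  have -> : d * (b + a) = 0.
    by rewrite /d mulrDr !mulrBl bb ba; zmod_solve.
  by rewrite mul0r.
have b0 : d * b * d = 0.
  apply: cpos_anti; first exact: conjd.
  have -> : - (d * b * d) = d * a * d.
    by apply/eqP; rewrite eq_sym -addr_eq0 addrC s0.
  exact: conjd.
have a0 : d * a * d = 0 by move: s0; rewrite b0 add0r.
apply/eqP; rewrite -subr_eq0; apply/eqP/cube_eq0 => //.
by rewrite -[RHS](subrr 0) -{1}b0 -a0 -mulrBl -mulrBr.
Qed.

(** Cauchy-Schwarz with p, q, r in the roles of the inner products (f, f), (g, g), (f, g), the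
    hypothesis being positivity at f - a g. Stated for bare elements, it covers single vectors and
    finite families alike. *)
Lemma gram_norm p q r : cpos q ->
  (forall a, cpos (p - a * star r - r * star a + a * q * star a)) ->
  `|r| ^+ 2 <= `|p| * `|q|.
Proof.
move=> pq h; apply: (@ler_add_eps _ _ _ `|p|) => // e e0; rewrite -mulrDr.
set k := `|q| + e; have k0 : 0 < k by rewrite ltr_wpDl.
have rr : `|k^-1%:C%C *: (r * star r)| <= `|p|.
  apply: cpos_le.
    apply: cposZ; first by rewrite invr_ge0 ltW.
    by rewrite -{1}(starK r); exact: cpos_star_mul.
  have pkq : cpos (k%:C%C *: (1 : A) - q).
    by apply: cpos_norm_sub; [exact: cpos_sa|rewrite lerDl ltW].
  (* At a = r / k, adding c (k - q) star c >= 0 replaces q by k and leaves p - r * star r / k >=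
     0. *)
  set c := k^-1%:C%C *: r; have := cposD (h c) (cpos_conj c pkq).
  rewrite mulrBr cscalerAr mulr1 scaler_inv ?gt_eqF// mulrBl.
  rewrite -(cscalerAl _ r (star r)) -/c.
  by move=> hh; congr cpos: hh; zmod_solve.
have rrE : `|r * star r| = `|r| ^+ 2.
  by rewrite -norm_star -(norm_star r) -norm_star_mul starK star_mul starK.
move: rr; rewrite norm_scaler rrE ger0_norm ?invr_ge0 ?(ltW k0)//.
by rewrite ler_pdivrMl// mulrC.
Qed.

End PositiveCone.

(** * Hilbert modules *)

Section HilbertBasics.
Variables (R : realType) (A : cstarAlgType R) (H : hilbertModType A).
Implicit Types (f g h : H) (a : A).

Lemma inner_scalel a f g : inner (a *: f) g = a * inner f g.
Proof. exact: innerZl. Qed.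

Lemma innerDr f g h : inner h (f + g) = inner h f + inner h g.
Proof. by rewrite -inner_star innerDl starD !inner_star. Qed.

Lemma inner_scaler a f g : inner f (a *: g) = inner f g * star a.
Proof. by rewrite -inner_star inner_scalel star_mul inner_star. Qed.

Lemma inner0l g : inner (0 : H) g = 0.
Proof. by apply: (@addrI _ (inner 0 g)); rewrite -innerDl !addr0. Qed.

Lemma innerNl f g : inner (- f) g = - inner f g.
Proof. by apply: (@addrI _ (inner f g)); rewrite -innerDl !subrr inner0l. Qed.

Lemma innerBl f g h : inner (f - g) h = inner f h - inner g h.
Proof. by rewrite innerDl innerNl. Qed.

Lemma innerNr f g : inner f (- g) = - inner f g.
Proof. by rewrite -inner_star innerNl starN inner_star. Qed.

Lemma innerBr f g h : inner h (f - g) = inner h f - inner h g.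
Proof. by rewrite innerDr innerNr. Qed.

Lemma inner0r g : inner g (0 : H) = 0.
Proof. by rewrite -inner_star inner0l star0. Qed.

Lemma inner_suml (I : Type) (r : seq I) (P : pred I) (F : I -> H) g :
  inner (\sum_(i <- r | P i) F i) g = \sum_(i <- r | P i) inner (F i) g.
Proof.
by apply: (big_morph (fun f => inner f g)) => [? ?|]; rewrite ?innerDl ?inner0l.
Qed.

Lemma norm_inner_self f : `|inner f f| = `|f| ^+ 2.
Proof. by rewrite hnormE sqr_sqrtr. Qed.

Lemma inner_self_eq0 f : inner f f = 0 -> f = 0.
Proof.
by move=> h; apply/eqP; rewrite -normr_eq0 -sqrf_eq0 -norm_inner_self h normr0.
Qed.

Lemma inner_inj g h : (forall f, inner f g = inner f h) -> g = h.
Proof.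
move=> e; apply/eqP; rewrite -subr_eq0; apply/eqP/inner_self_eq0.
by rewrite innerBr e subrr.
Qed.

Lemma cauchy_schwarz f g : `|inner f g| <= `|f| * `|g|.
Proof.
rewrite -(@ler_sqr R) ?nnegrE ?mulr_ge0// exprMn -!norm_inner_self.
apply: gram_norm => [|a]; first exact: inner_pos.
have := inner_pos (f - a *: g).
rewrite !(innerBl, innerBr, inner_scalel, inner_scaler) inner_star.
by move=> h; congr cpos: h; ncring.
Qed.

Lemma norm_act a f : `|a *: f| <= `|a| * `|f|.
Proof.
rewrite -(@ler_sqr R) ?nnegrE ?mulr_ge0// -norm_inner_self.
rewrite inner_scalel inner_scaler exprMn -norm_inner_self.
rewrite (le_trans (norm_mul _ _))// expr2 -mulrA ler_wpM2l//.
by rewrite (le_trans (norm_mul _ _))// norm_star mulrC.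
Qed.

Lemma inner_hscalel (c : R[i]) f g : inner (hscale c f) g = c *: inner f g.
Proof. by rewrite inner_scalel cscalerAl mul1r. Qed.

Lemma inner_hscaler (c : R[i]) f g : inner f (hscale c g) = conjc c *: inner f g.
Proof. by rewrite -inner_star inner_hscalel star_scale inner_star. Qed.

Lemma norm_hscale (c : R[i]) f : `|hscale c f| = complex.Re `|c| * `|f|.
Proof.
have c0 : 0 <= complex.Re `|c| by rewrite normc_def /= sqrtr_ge0.
have cc : complex.Re `|conjc c| = complex.Re `|c|.
  by rewrite !normc_def; case: c {c0} => x y /=; rewrite sqrrN.
apply/eqP; rewrite -(@eqrXn2 _ 2) ?mulr_ge0// -norm_inner_self.
rewrite inner_hscalel inner_hscaler exprMn -norm_inner_self.
by rewrite -[_ *: (_ *: _)]/(Defs.cscale _ (Defs.cscale _ _)) !cnormZ cc mulrA.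
Qed.

End HilbertBasics.

(** * The C*-algebra of adjointable operators *)

(* Adjointable operators are automatically bounded, by the uniform boundedness
   principle; making boundedness a field avoids proving it. *)
Record adjop (R : realType) (A : cstarAlgType R) (H : hilbertModType A) :=
  AdjOp {
    adj_fun :> H -> H;
    adj_star : H -> H;
    adj_inner : forall f g, inner (adj_fun f) g = inner f (adj_star g);
    adj_bounded : bounded_op adj_fun }.

Section AdjointableOperators.
Variables (R : realType) (A : cstarAlgType R) (H : hilbertModType A).
Local Notation E := (adjop H).
Implicit Types (S T U : E) (f g h : H).

Lemma bounded_opP (T : H -> H) :
  bounded_op T -> exists2 M : R, 0 <= M & forall f, `|T f| <= M * `|f|.
Proof.
move=> [M hM]; exists `|M| => // f; rewrite (le_trans (hM f))//.
by rewrite ler_wpM2r// ler_norm.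
Qed.

(** The inner product separates points, so the adjoint field is determined by the operator. *)
Lemma adjopP S T : (forall f, S f = T f) -> S = T.
Proof.
case: S T => [s s' hs bs] [t t' ht bt] /= st.
have {}st : s = t by apply/funext.
have st' : s' = t'.
  by apply/funext => g; apply: inner_inj => f; rewrite -hs -ht st.
case: _ / st in hs bs ht bt *; case: _ / st' in hs ht *.
by congr AdjOp; exact: Prop_irrelevance.
Qed.

Lemma adj_inner_star T f g : inner (adj_star T f) g = inner f (T g).
Proof. by rewrite -inner_star -adj_inner inner_star. Qed.

Lemma adjopD T f g : T (f + g) = T f + T g.
Proof.
apply: inner_inj => h; rewrite innerDr -!(inner_star _ h) !adj_inner.
by rewrite -starD -innerDl.
Qed.

Lemma adjopZ T (a : A) f : T (a *: f) = a *: T f.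
Proof.
apply: inner_inj => h; rewrite inner_scaler -!(inner_star _ h) !adj_inner.
by rewrite inner_scalel star_mul.
Qed.

Lemma adjop0 T : T 0 = 0.
Proof. by apply: (@addrI _ (T 0)); rewrite -adjopD !addr0. Qed.

(** Cauchy-Schwarz gives |T^* f|^2 <= |f| |T T^* f| <= M |f| |T^* f|. *)
Lemma adj_star_le T (M : R) : 0 <= M -> (forall f, `|T f| <= M * `|f|) ->
  forall f, `|adj_star T f| <= M * `|f|.
Proof.
move=> M0 hM f; have [->|n0] := eqVneq `|adj_star T f| 0.
  by rewrite mulr_ge0.
have p0 : 0 < `|adj_star T f| by rewrite lt_def n0 normr_ge0.
rewrite -(ler_pM2r p0).
rewrite -expr2 -norm_inner_self adj_inner_star (le_trans (cauchy_schwarz _ _))//.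
by rewrite mulrAC mulrC ler_wpM2r// hM.
Qed.

Program Definition adjop_zero : E := @AdjOp R A H (fun=> 0) (fun=> 0) _ _.
Next Obligation. by move=> * /=; rewrite inner0l inner0r. Qed.
Next Obligation. by exists 0 => f; rewrite normr0 mul0r. Qed.

Program Definition adjop_add S T : E :=
  @AdjOp R A H (fun f => S f + T f) (fun f => adj_star S f + adj_star T f) _ _.
Next Obligation. by move=> * /=; rewrite innerDl innerDr !adj_inner. Qed.
Next Obligation.
move=> S T; have [M hM] := adj_bounded S; have [N hN] := adj_bounded T.
exists (M + N) => f; rewrite mulrDl (le_trans (ler_normD _ _))//.
by rewrite lerD.
Qed.

Program Definition adjop_opp T : E :=
  @AdjOp R A H (fun f => - T f) (fun f => - adj_star T f) _ _.
Next Obligation. by move=> * /=; rewrite innerNl innerNr !adj_inner. Qed.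
Next Obligation.
by move=> T; have [M hM] := adj_bounded T; exists M => f; rewrite normrN.
Qed.

Program Definition adjop_one : E := @AdjOp R A H id id _ _.
Next Obligation. by []. Qed.
Next Obligation. by exists 1 => f; rewrite mul1r. Qed.

Program Definition adjop_mul S T : E :=
  @AdjOp R A H (S \o T) (adj_star T \o adj_star S) _ _.
Next Obligation. by move=> * /=; rewrite !adj_inner. Qed.
Next Obligation.
move=> S T; have [M M0 hM] := bounded_opP (adj_bounded S); have [N hN] := adj_bounded T.
by exists (M * N) => f /=; rewrite (le_trans (hM _))// -mulrA ler_wpM2l.
Qed.

Program Definition adjop_scale (c : R[i]) T : E :=
  @AdjOp R A H (fun f => hscale c (T f))
    (fun f => hscale (conjc c) (adj_star T f)) _ _.
Next Obligation.
by move=> * /=; rewrite inner_hscalel inner_hscaler adj_inner conjcK.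
Qed.
Next Obligation.
move=> c T; have [M hM] := adj_bounded T; exists (complex.Re `|c| * M) => f.
by rewrite norm_hscale -mulrA ler_wpM2l// normc_def sqrtr_ge0.
Qed.

Program Definition adjop_star T : E := @AdjOp R A H (adj_star T) T _ _.
Next Obligation. exact: adj_inner_star. Qed.
Next Obligation.
move=> T; have [M M0 hM] := bounded_opP (adj_bounded T).
by exists M; exact: adj_star_le.
Qed.

(** The condition [0 <= M] keeps the set bounded below when H is zero. *)
Definition adjop_norm T : R :=
  inf [set M : R | 0 <= M /\ forall f, `|T f| <= M * `|f|].

Let norm_lb T : has_lbound [set M : R | 0 <= M /\ forall f, `|T f| <= M * `|f|].
Proof. by exists 0 => M []. Qed.

Let norm_neq0 T :
  [set M : R | 0 <= M /\ forall f, `|T f| <= M * `|f|] !=set0.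
Proof. by have [M M0 hM] := bounded_opP (adj_bounded T); exists M. Qed.

Lemma adjop_norm_le T (M : R) :
  0 <= M -> (forall f, `|T f| <= M * `|f|) -> adjop_norm T <= M.
Proof. by move=> M0 hM; apply: ge_inf. Qed.

Lemma adjop_norm_ge0 T : 0 <= adjop_norm T.
Proof. by apply: lb_le_inf => // M []. Qed.

Lemma adjop_normP T f : `|T f| <= adjop_norm T * `|f|.
Proof.
have [->|f0] := eqVneq f 0; first by rewrite adjop0 !normr0 mulr0.
rewrite -ler_pdivrMr ?normr_gt0//; apply: lb_le_inf => // M [M0 hM].
by rewrite ler_pdivrMr ?normr_gt0.
Qed.

HB.instance Definition _ := gen_eqMixin E.
HB.instance Definition _ := gen_choiceMixin E.

Let addA : associative adjop_add.
Proof. by move=> S T U; apply: adjopP => f /=; rewrite addrA. Qed.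
Let addC : commutative adjop_add.
Proof. by move=> S T; apply: adjopP => f /=; rewrite addrC. Qed.
Let add0 : left_id adjop_zero adjop_add.
Proof. by move=> S; apply: adjopP => f /=; rewrite add0r. Qed.
Let addN : left_inverse adjop_zero adjop_opp adjop_add.
Proof. by move=> S; apply: adjopP => f /=; rewrite addNr. Qed.

HB.instance Definition _ := GRing.isZmodule.Build E addA addC add0 addN.

Let normD S T : adjop_norm (S + T) <= adjop_norm S + adjop_norm T.
Proof.
apply: adjop_norm_le => [|f]; first by rewrite addr_ge0// adjop_norm_ge0.
by rewrite mulrDl (le_trans (ler_normD _ _))// lerD// adjop_normP.
Qed.

Let norm0 T : adjop_norm T = 0 -> T = 0.
Proof.
move=> T0; apply: adjopP => f; apply/eqP; rewrite -normr_le0.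
by rewrite (le_trans (adjop_normP T f))// T0 mul0r.
Qed.

Lemma adjop_mulrn T n f : (T *+ n) f = T f *+ n.
Proof. by elim: n => [|n ih]; rewrite ?mulr0n// !mulrS -ih. Qed.

Let normMn T n : adjop_norm (T *+ n) = adjop_norm T *+ n.
Proof.
apply/le_anti/andP; split.
  apply: adjop_norm_le => [|f]; first by rewrite mulrn_wge0// adjop_norm_ge0.
  by rewrite adjop_mulrn normrMn mulrnAl lerMn2r adjop_normP orbT.
case: n => [|n]; first by rewrite mulr0n adjop_norm_ge0.
rewrite -mulr_natr -ler_pdivlMr ?ltr0n//; apply: adjop_norm_le => [|f].
  by rewrite divr_ge0// adjop_norm_ge0.
rewrite mulrAC ler_pdivlMr ?ltr0n// mulr_natr -normrMn -adjop_mulrn.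
exact: adjop_normP.
Qed.

Let normN T : adjop_norm (- T) = adjop_norm T.
Proof.
by congr inf; apply/seteqP; split => M [M0 hM]; split=> // f;
  have := hM f; rewrite /= normrN.
Qed.

HB.instance Definition _ :=
  Num.Zmodule_isNormed.Build R E normD norm0 normMn normN.
HB.instance Definition _ := PseudoMetric.copy E (pseudoMetric_normed E).
HB.instance Definition _ := isPointed.Build E 0.
HB.instance Definition _ := NormedZmod_PseudoMetric_eq.Build R E erefl.

Lemma norm_adjop_le T (M : R) :
  0 <= M -> (forall f, `|T f| <= M * `|f|) -> `|T| <= M.
Proof. exact: adjop_norm_le. Qed.

Lemma norm_adjopP T f : `|T f| <= `|T| * `|f|.
Proof. exact: adjop_normP. Qed.

End AdjointableOperators.

(** * Completeness and the C*-identity for adjointable operators *)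

Section AdjopComplete.
Variables (R : realType) (A : cstarAlgType R) (H : hilbertModType A).
Local Notation E := (adjop H).
Implicit Types (S T U : E) (f g h : H).

Lemma adjopDE S T f : (S + T) f = S f + T f. Proof. by []. Qed.

Lemma adjopBE S T f : (S - T) f = S f - T f. Proof. by []. Qed.

Lemma adj_starB S T f : adj_star (S - T) f = adj_star S f - adj_star T f.
Proof. by []. Qed.

Lemma norm_adj_star T f : `|adj_star T f| <= `|T| * `|f|.
Proof. by apply: adj_star_le => // g; exact: norm_adjopP. Qed.

(** An operator and its adjoint obey the same norm bound, so both converge pointwise along F, and
    the adjoint relation passes to the limits. *)
Lemma adjop_complete (F : set_system E) : ProperFilter F -> cauchy F -> cvg F.
Proof.
move=> PF /cauchyP cF.
have small e : 0 < e -> exists T, \forall S \near F, `|T - S| < e.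
  by move=> /cF[T hT]; exists T; near=> S; have : ball T e S by near: S.
(* [ev] stands for evaluation of the operator or of its adjoint. *)
have cv (ev : E -> H -> H) f :
  (forall S T g, `|ev S g - ev T g| <= `|S - T| * `|g|) -> cvg (ev^~ f @ F).
  move=> hev; apply: hilbert_complete; apply: cauchy_exP => e e0.
  have e1 : 0 < e / (`|f| + 1) by rewrite divr_gt0// ltr_wpDl.
  have [T hT] := small _ e1; exists (ev T f).
  rewrite /fmap /=; near=> S.
  rewrite -ball_normE /=.
  rewrite (le_lt_trans (hev _ _ _))//.
  have : `|T - S| < e / (`|f| + 1) by near: S.
  rewrite ltr_pdivlMr ?ltr_wpDl// => /le_lt_trans; apply.
  by rewrite mulrDr lerDl mulr1.
have cfun f : cvg ((fun S : E => S f) @ F).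
  by apply: (cv (fun S f => S f)) => S T g; rewrite -adjopBE norm_adjopP.
have cstar f : cvg ((fun S : E => adj_star S f) @ F).
  by apply: (cv (fun S f => adj_star S f)) => S T g; rewrite -adj_starB norm_adj_star.
pose L f := lim ((fun S : E => S f) @ F).
pose Ls f := lim ((fun S : E => adj_star S f) @ F).
have near_L (T : E) e f : (\forall S \near F, `|T - S| < e) ->
    `|L f - T f| <= e * `|f|.
  move=> hT; apply: (@ler_add_eps _ _ _ 1) => // d d0.
  have /cvgr_dist_lt/(_ _ d0) nL := cfun f.
  near F => S.
  have h1 : `|L f - S f| < d by near: S; exact: nL.
  have h2 : `|T - S| < e by near: S.
  have -> : L f - T f = (L f - S f) - (T - S) f by rewrite adjopBE; zmod_solve.
  rewrite (le_trans (ler_normB _ _))// mul1r addrC lerD//; last exact: ltW.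
  by rewrite (le_trans (norm_adjopP _ _))// ler_wpM2r// ltW.
have LE f g : inner (L f) g = inner f (Ls g).
  apply/eqP; rewrite -subr_eq0; apply/eqP.
  apply: (@norm_eq0_eps _ _ _ (`|g| + `|f|)); first by rewrite addr_ge0.
  move=> e e0; have /cvgr_dist_lt/(_ _ e0) nL := cfun f.
  have /cvgr_dist_lt/(_ _ e0) nLs := cstar g; near F => S.
  have h1 : `|L f - S f| < e by near: S; exact: nL.
  have h2 : `|Ls g - adj_star S g| < e by near: S; exact: nLs.
  have -> : inner (L f) g - inner f (Ls g) =
      inner (L f - S f) g - inner f (Ls g - adj_star S g).
    by rewrite innerBl innerBr adj_inner; zmod_solve.
  rewrite (le_trans (ler_normB _ _))// mulrDl lerD//.
    by rewrite (le_trans (cauchy_schwarz _ _))// mulrC ler_wpM2l// ltW.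
  by rewrite (le_trans (cauchy_schwarz _ _))// ler_wpM2l// ltW.
have Lb : bounded_op L.
  have [T hT] := small 1 ltr01; exists (1 + `|T|) => f.
  rewrite -(subrK (T f) (L f)) mulrDl (le_trans (ler_normD _ _))// lerD//.
    exact: near_L.
  exact: norm_adjopP.
apply/cvg_ex; exists (AdjOp LE Lb); apply/fcvgrPdist_lt => e e0.
have e2 : 0 < e / 4 by rewrite divr_gt0.
have [T hT] := small _ e2; near=> S.
have hS : `|T - S| < e / 4 by near: S.
have hL : `|AdjOp LE Lb - T| <= e / 4.
  apply: norm_adjop_le => [|f]; first exact: ltW.
  exact: near_L.
have -> : AdjOp LE Lb - S = (AdjOp LE Lb - T) + (T - S) by zmod_solve.
rewrite (le_lt_trans (ler_normD _ _))//; lra.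
Unshelve. all: by end_near. Qed.

Let mulA : associative (@adjop_mul R A H).
Proof. by move=> S T U; apply: adjopP. Qed.
Let mul1 : left_id (adjop_one H) (@adjop_mul R A H).
Proof. by move=> S; apply: adjopP. Qed.
Let mulr1 : right_id (adjop_one H) (@adjop_mul R A H).
Proof. by move=> S; apply: adjopP. Qed.
Let mulDl : left_distributive (@adjop_mul R A H) +%R.
Proof. by move=> S T U; apply: adjopP. Qed.
Let mulDr : right_distributive (@adjop_mul R A H) +%R.
Proof. by move=> S T U; apply: adjopP => f /=; rewrite adjopD. Qed.
Let scaleA (c d : R[i]) T :
  adjop_scale c (adjop_scale d T) = adjop_scale (c * d) T.
Proof.
by apply: adjopP => f /=; rewrite /hscale scalerA cscalerAl mul1r scalerA.
Qed.
Let scale1 : left_id 1 (@adjop_scale R A H).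
Proof. by move=> T; apply: adjopP => f /=; rewrite /hscale !scale1r. Qed.
Let scaleDr : right_distributive (@adjop_scale R A H) +%R.
Proof. by move=> c S T; apply: adjopP => f /=; rewrite /hscale scalerDr. Qed.
Let scaleDl T : {morph (@adjop_scale R A H)^~ T : c d / c + d}.
Proof. by move=> c d; apply: adjopP => f /=; rewrite /hscale !scalerDl. Qed.
Let scaleAl (c : R[i]) S T :
  adjop_scale c (adjop_mul S T) = adjop_mul (adjop_scale c S) T.
Proof. exact: adjopP. Qed.
Let scaleAr (c : R[i]) S T :
  adjop_scale c (adjop_mul S T) = adjop_mul S (adjop_scale c T).
Proof. by apply: adjopP => f /=; rewrite /hscale adjopZ. Qed.
Let starD : {morph (@adjop_star R A H) : S T / S + T}.
Proof. by move=> S T; apply: adjopP. Qed.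
Let starZ (c : R[i]) T :
  adjop_star (adjop_scale c T) = adjop_scale (conjc c) (adjop_star T).
Proof. exact: adjopP. Qed.
Let starM S T :
  adjop_star (adjop_mul S T) = adjop_mul (adjop_star T) (adjop_star S).
Proof. exact: adjopP. Qed.
Let starK : involutive (@adjop_star R A H).
Proof. by move=> T; apply: adjopP. Qed.

Let normZ_le (c : R[i]) T : `|adjop_scale c T| <= complex.Re `|c| * `|T|.
Proof.
have c0 : 0 <= complex.Re `|c| by rewrite normc_def sqrtr_ge0.
apply: norm_adjop_le => [|f]; first by rewrite mulr_ge0.
by rewrite norm_hscale -mulrA ler_wpM2l// norm_adjopP.
Qed.

Let normZ (c : R[i]) T : `|adjop_scale c T| = complex.Re `|c| * `|T|.
Proof.
apply/le_anti; rewrite normZ_le andTb.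
have [->|c0] := eqVneq c 0; first by rewrite normr0 /= mul0r.
(* The reverse inequality is the upper bound for the scalar c^-1 applied to c T. *)
have := normZ_le c^-1 (adjop_scale c T); rewrite scaleA mulVf// scale1.
have cE (z : R[i]) : `|z| = (complex.Re `|z|)%:C%C by rewrite normc_def.
have p0 : 0 < complex.Re `|c|.
  by have := c0; rewrite -normr_gt0 cE ltcR.
rewrite normfV cE -fmorphV /= -(ler_pM2l p0) mulrA mulfV ?gt_eqF// mul1r.
by [].
Qed.

Let normM S T : `|adjop_mul S T| <= `|S| * `|T|.
Proof.
apply: norm_adjop_le => [|f]; first by rewrite mulr_ge0.
rewrite (le_trans (norm_adjopP S (T f)))// -mulrA ler_wpM2l//.
exact: norm_adjopP.
Qed.

Let norm_starM T : `|adjop_mul (adjop_star T) T| = `|T| ^+ 2.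
Proof.
apply/le_anti/andP; split.
  rewrite (le_trans (normM _ _))// expr2 ler_wpM2r//.
  by apply: norm_adjop_le => // f; exact: norm_adj_star.
set N := `|adjop_mul _ _|.
have N0 : 0 <= N by exact: normr_ge0.
rewrite -(sqr_sqrtr N0) (@ler_sqr R) ?nnegrE ?sqrtr_ge0//.
apply: norm_adjop_le => [|f]; first exact: sqrtr_ge0.
rewrite -(@ler_sqr R) ?nnegrE ?mulr_ge0 ?sqrtr_ge0// exprMn sqr_sqrtr//.
rewrite -norm_inner_self -adj_inner_star (le_trans (cauchy_schwarz _ _))//.
by rewrite expr2 mulrA ler_wpM2r// (norm_adjopP (adjop_mul (adjop_star T) T)).
Qed.

HB.instance Definition _ := isCstarAlgebra.Build R E adjop_complete
  mulA mul1 mulr1 mulDl mulDr scaleA scale1 scaleDr scaleDl scaleAl scaleAr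
  starD starZ starM starK normZ normM norm_starM.

HB.instance Definition _ := GRing.PzRing.copy E (CstarAlgebra.sort E).
HB.instance Definition _ := GRing.Lmodule.copy E (CstarAlgebra.sort E).

Lemma adjopME S T f : (S * T) f = S (T f). Proof. by []. Qed.

Lemma adjopZE (c : R[i]) T f : (c *: T) f = hscale c (T f). Proof. by []. Qed.

Lemma star_adjopE T f : star T f = adj_star T f. Proof. by []. Qed.

End AdjopComplete.

(** * Positive operators as positive elements of the operator algebra *)

Section PositiveOperators.
Variables (R : realType) (A : cstarAlgType R) (H : hilbertModType A).
Local Notation E := (adjop H).
Implicit Types (P Q S T U : E) (f g h : H).

Lemma inner_injl f g : (forall h, inner f h = inner g h) -> f = g.
Proof. by move=> e; apply: inner_inj => h; rewrite -!(inner_star _ h) e. Qed.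

Lemma hscale1 f : hscale 1 f = f.
Proof. by rewrite /hscale !scale1r. Qed.

Lemma clinear_adjop T : clinear T.
Proof. by move=> c f g; rewrite adjopD /hscale adjopZ. Qed.

(** Polarisation: the defect D is sesquilinear and vanishes on the diagonal, so it is antisymmetric.
    Replacing f by i f then gives i D = - i D. This makes a complex-linear positive map its own
    adjoint, hence an element of [adjop H]. *)
Lemma positive_op_sym (T : H -> H) : clinear T -> positive_op T ->
  forall f g, inner (T f) g = inner f (T g).
Proof.
move=> lT pT.
have TD f g : T (f + g) = T f + T g by have := lT 1 f g; rewrite !hscale1.
have T0 : T 0 = 0 by apply: (@addrI _ (T 0)); rewrite -TD !addr0.
have TZ c f : T (hscale c f) = hscale c (T f).
  by have := lT c f 0; rewrite T0 !addr0.
pose D f g := inner (T f) g - inner f (T g).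
have D0 f : D f f = 0.
  by rewrite /D -(inner_star (T f) f) (cpos_sa (pT f)) subrr.
have DN f g : D g f = - D f g.
  apply/eqP; rewrite -addr_eq0; apply/eqP.
  rewrite -[RHS](D0 (f + g)) -[LHS]addr0 -[in LHS](D0 f) -[LHS]addr0.
  rewrite -[in LHS](D0 g) /D TD !(innerDl, innerDr); zmod_solve.
have DZl c f g : D (hscale c f) g = c *: D f g.
  by rewrite /D TZ !inner_hscalel scalerBr.
have DZr c f g : D f (hscale c g) = conjc c *: D f g.
  by rewrite /D TZ !inner_hscaler scalerBr.
have DS f g : 'i%C *: D f g = - ('i%C *: D f g).
  have := DN (hscale 'i%C f) g; rewrite DZl DZr (DN f g) scalerN -scaleNr.
  suff -> : - conjc 'i%C = 'i%C :> R[i] by [].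
  by apply/eqP; rewrite eq_complex/= oppr0 opprK !eqxx.
move=> f g; apply/eqP; rewrite -subr_eq0 -/(D f g) -normr_eq0 -norm_scalei.
rewrite normr_eq0; set x := 'i%C *: _.
have xx : x + x = 0 by rewrite {1}/x DS addNr.
have : 2%:C%C *: x = 0.
  by rewrite (_ : 2 = 1 + 1)// rmorphD rmorph1 scalerDl scale1r.
move=> /(congr1 (fun x : A => `|x|)); rewrite norm_scaler normr0 => /eqP.
by rewrite mulf_eq0 normr_eq0 pnatr_eq0/= normr_eq0.
Qed.

(** For the direct implication, [negative_part] gives u T u = - v^2. Positivity of T at u f says
    that - (v f, v f) is positive, so v = 0. *)
Lemma positive_opP T : positive_op T <-> cpos T.
Proof.
split=> [pT|[b ->] f]; last first.
  by rewrite adjopME adj_inner_star; exact: inner_pos.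
have sT : star T = T.
  apply: adjopP => f; apply: inner_injl => h; rewrite star_adjopE adj_inner_star.
  by rewrite (positive_op_sym (@clinear_adjop T)).
have [u [v [su sv uTu vP]]] := negative_part sT.
rewrite -norm_posE; apply: vP; apply: adjopP => f.
have adj_sa S g h : star S = S -> inner (S g) h = inner g (S h).
  by move=> sS; rewrite adj_inner -star_adjopE sS.
apply/inner_self_eq0/cpos_anti; first exact: inner_pos.
have := pT (u f); rewrite -(adj_sa u)//.
have -> : u (T (u f)) = (u * T * u) f by [].
rewrite uTu; have -> : (- (v * v)) f = - v (v f) by [].
by rewrite innerNl adj_sa.
Qed.

Lemma positive_op_adjop (T : H -> H) :
  clinear T -> bounded_op T -> positive_op T ->
  exists2 S : E, cpos S & (S : H -> H) = T.
Proof.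
move=> lT bT pT.
exists (AdjOp (positive_op_sym lT pT) bT) => //.
exact/positive_opP.
Qed.

(** The root w of q commutes with p, and p q = w p w. *)
Lemma cposM (B : cstarAlgType R) (p q : B) :
  cpos p -> cpos q -> p * q = q * p -> cpos (p * q).
Proof.
move=> pp /cpos_sqrt[w [pw ww wQ]] pq.
have wp : w * p = p * w by apply: (wQ _ (calculus_comm p)).
have := cpos_conj w pp; rewrite (cpos_sa pw) wp -mulrA ww.
by [].
Qed.

(** [op_sqrt] chooses among plain maps on H; existence of a root makes the choice meaningful, and
    [positive_op_adjop] brings the chosen map back into the operator algebra. *)
Lemma op_sqrtP P : cpos P ->
  exists S : E, [/\ cpos S, op_sqrt P = S & S * S = P].
Proof.
move=> pP.
have : op_sqrt P \in [set S : H -> H |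
    [/\ clinear S, bounded_op S, positive_op S & S \o S = P]].
  rewrite inE; apply: getPex; have [S [pS SS _]] := cpos_sqrt pP.
  exists (adj_fun S); split.
  - exact: clinear_adjop.
  - exact: adj_bounded.
  - exact/positive_opP.
  - by rewrite -SS.
rewrite inE => -[lS bS pS SS].
have [S cS SE] := positive_op_adjop lS bS pS.
exists S; split=> //; apply: adjopP => f.
by rewrite adjopME SE -[LHS]/((op_sqrt P \o op_sqrt P) f) SS.
Qed.

(* The condition passes to limits because having an adjoint makes [D] closed. *)
Lemma calculus_comm_adjoint (D D' : H -> H) :
  (forall f g, inner (D f) g = inner f (D' g)) ->
  closed_calculus (fun S : E => forall f, S (D f) = D (S f)).
Proof.
move=> DD'.
have DD f g : D (f + g) = D f + D g.
  by apply: inner_injl => h; rewrite innerDl !DD' innerDl.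
have DZ a f : D (a *: f) = a *: D f.
  by apply: inner_injl => h; rewrite inner_scalel !DD' inner_scalel.
split=> [//|t S hS f|S T hS hT f|S hS f|S hS f].
- by rewrite !adjopZE hS /hscale DZ.
- by rewrite !adjopDE hS hT DD.
- by rewrite !adjopME !hS.
apply: inner_injl => h; apply/eqP; rewrite -subr_eq0; apply/eqP.
apply: (@norm_eq0_eps _ _ _ (`|D f| * `|h| + `|f| * `|D' h|)).
  by rewrite addr_ge0 ?mulr_ge0.
move=> e e0; have [T hT ST] := hS e e0.
have -> : inner (S (D f)) h - inner (D (S f)) h =
    inner ((S - T) (D f)) h - inner ((S - T) f) (D' h).
  rewrite !adjopBE !innerBl hT !DD'; zmod_solve.
have bd g k : `|inner ((S - T) g) k| <= `|g| * `|k| * e.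
  rewrite (le_trans (cauchy_schwarz _ _))// mulrAC ler_wpM2r// mulrC.
  by rewrite (le_trans (norm_adjopP _ _))// ler_wpM2r// ltW.
by rewrite (le_trans (ler_normB _ _))// mulrDl lerD.
Qed.

Lemma adjointP (K : set H) (L : H -> H) : adjointable_into K L ->
  forall f g, K g -> inner (L f) g = inner f (adjoint L g).
Proof.
move=> [_ _ [Ls hLs]] f g Kg.
have : adjoint L g \in [set h : H | forall f : H, inner (L f) g = inner f h].
  by rewrite inE; apply: getPex; exists (Ls g) => f'; exact: hLs.
by rewrite inE; apply.
Qed.

Lemma adjoint_lin (K : set H) (L : H -> H) (a : A) g h :
  adjointable_into K L -> closed_submodule K -> K g -> K h ->
  adjoint L (a *: g + h) = a *: adjoint L g + adjoint L h.
Proof.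
move=> hL [_ _ hK] Kg Kh; apply: inner_inj => f.
rewrite innerDr inner_scaler -!(adjointP hL) ?innerDr ?inner_scaler//.
exact: hK.
Qed.

End PositiveOperators.

#[local] Existing Instance totally_filter.

(** * Unordered sums *)

Section UnorderedSumLemmas.
Variables (R : realType) (J : choiceType).
Implicit Types (F G : {fset J}).

Lemma partial_sumE (V : zmodType) (x : J -> V) F :
  partial_sum x F = \sum_(j <- F) x j.
Proof. by rewrite big_seq_fsetE. Qed.

Lemma partial_sum_sub (V : zmodType) (x : J -> V) F G : (F `<=` G)%fset ->
  partial_sum x G = partial_sum x F + partial_sum x (G `\` F)%fset.
Proof.
move=> FG; rewrite !partial_sumE (big_fsetID _ (mem F) G) /=; congr (_ + _).
  congr (\sum_(j <- enum_fset _) _); apply/fsetP => j; rewrite !inE /=.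
  by case: (boolP (j \in F)) => [/(fsubsetP FG) ->|]; rewrite ?andbF.
by congr (\sum_(j <- enum_fset _) _); apply/fsetP => j; rewrite !inE /= andbC.
Qed.

(** The Cauchy criterion is phrased with sums over finite sets disjoint from [F0], the form to which
    estimates for finite families apply directly. *)
Lemma usummable_small (V : pseudoMetricNormedZmodType R) (x : J -> V) (e : R) :
  usummable x -> 0 < e -> exists F0, forall F, (F0 `<=` F)%fset ->
    `|partial_sum x (F `\` F0)%fset| < e.
Proof.
move=> sx e0; have e2 : 0 < e / 2 by rewrite divr_gt0.
have /cvgr_dist_lt/(_ _ e2)[F0 _ h] := sx.
exists F0 => F F0F; have h0 := h F0 (fsubset_refl _); have hF := h F F0F.
rewrite (_ : partial_sum x _ =
   (lim (partial_sum x @ totally) - partial_sum x F0) -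
   (lim (partial_sum x @ totally) - partial_sum x F)); last first.
  by rewrite (partial_sum_sub x F0F); zmod_solve.
rewrite (le_lt_trans (ler_normB _ _))//; move: h0 hF => /=; lra.
Qed.

Lemma usummable_complete (V : pseudoMetricNormedZmodType R) (x : J -> V) :
  (forall S : set_system V, ProperFilter S -> cauchy S -> cvg S) ->
  (forall e : R, 0 < e -> exists F0, forall F, (F0 `<=` F)%fset ->
    `|partial_sum x (F `\` F0)%fset| < e) ->
  usummable x.
Proof.
move=> cV h; apply: cV; apply: cauchy_exP => e e0.
have [F0 hF0] := h e e0; exists (partial_sum x F0), F0 => // F /= F0F.
rewrite -ball_normE/= (partial_sum_sub x F0F) opprD addrA subrr sub0r normrN.
exact: hF0.
Qed.

Lemma usum_finite (V : pseudoMetricNormedZmodType R) (x : J -> V) F :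
  (forall j, j \notin F -> x j = 0) ->
  usummable x /\ usum x = partial_sum x F.
Proof.
move=> x0.
have cx : partial_sum x @ totally --> partial_sum x F.
  apply/cvgrPdist_lt => e e0; exists F => // G /= FG.
  rewrite (partial_sum_sub x FG) opprD addrA subrr sub0r normrN.
  rewrite partial_sumE big_seq big1 ?normr0// => j.
  by rewrite inE => /andP[/x0].
by split; [apply/cvg_ex; exists (partial_sum x F)|exact: norm_cvg_lim].
Qed.

Section HilbertSums.
Variables (A : cstarAlgType R) (H : hilbertModType A).
Implicit Types (g u : J -> H).

Lemma cpos_partial_sum (x : J -> A) F :
  (forall j, cpos (x j)) -> cpos (partial_sum x F).
Proof. by move=> h; exact: cpos_sum. Qed.

(** Positivity of the sum of the inner squares of g_j - a u_j is the hypothesis of [gram_norm]. *)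
Lemma cauchy_schwarz_sum g u F :
  `|partial_sum (fun j => inner (g j) (u j)) F| ^+ 2 <=
  `|partial_sum (fun j => inner (g j) (g j)) F| *
  `|partial_sum (fun j => inner (u j) (u j)) F|.
Proof.
apply: gram_norm => [|a]; first by apply: cpos_partial_sum => j; exact: inner_pos.
have := @cpos_partial_sum (fun j => inner (g j - a *: u j) (g j - a *: u j)) F.
move=> /(_ (fun j => inner_pos _)); congr cpos; rewrite /partial_sum.
have -> : star (\sum_(i : F) inner (g (val i)) (u (val i))) =
    \sum_(i : F) inner (u (val i)) (g (val i)).
  rewrite (big_morph star (@starD R A) (star0 A)).
  by apply: eq_bigr => i _; rewrite inner_star.
rewrite !(mulr_sumr, mulr_suml) -!sumrB -big_split /=; apply: eq_bigr => i _.
rewrite !(innerBl, innerBr, inner_scalel, inner_scaler); ncring.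
Qed.

(** Given F, the tolerance is met on F joined with F0, and positivity of the added terms brings the
    bound back to F up to e / 2. Closedness of the cone removes the error. *)
Lemma usum_leP (x : J -> A) (b : A) : (forall j, cpos (x j)) -> star b = b ->
  usum_le x b <-> forall F, cpos (b - partial_sum x F).
Proof.
move=> px sb; split=> [h F|h e e0]; last first.
  exists fset0 => // F _; exists (partial_sum x F); first exact: h.
  by rewrite subrr normr0.
apply: cpos_closed => e e0; have e2 : 0 < e / 2 by rewrite divr_gt0.
have [F0 _ hF0] := h _ e2.
have [a ab xa] := hF0 (F `|` F0)%fset (fsubsetUr _ _).
(* Positivity of b - a with b self-adjoint forces a to be self-adjoint. *)
have sxa : star (partial_sum x (F `|` F0)%fset - a) =
    partial_sum x (F `|` F0)%fset - a.
  have := cpos_sa ab; rewrite !starB sb => /addrI/oppr_inj ->.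
  by rewrite (cpos_sa (cpos_partial_sum _ px)).
exists (b - partial_sum x F + (e / 2)%:C%C *: (1 : A)); last first.
  rewrite opprD addrA subrr sub0r normrN norm_scaler gtr0_norm//.
  have := norm1_le1 A => h1.
  by rewrite (@le_lt_trans _ _ (e / 2))// ?ger_pMr//; lra.
have -> : b - partial_sum x F + (e / 2)%:C%C *: (1 : A) =
    (b - a) + ((e / 2)%:C%C *: (1 : A) - (partial_sum x (F `|` F0)%fset - a)) +
    partial_sum x ((F `|` F0) `\` F)%fset.
  by rewrite (partial_sum_sub x (fsubsetUl F F0)); zmod_solve.
apply: cposD; last exact: cpos_partial_sum.
by apply: cposD => //; apply: cpos_norm_sub => //; exact: ltW.
Qed.

End HilbertSums.

End UnorderedSumLemmas.

(** * The synthesis operator *)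

Section Synthesis.
Variables (R : realType) (A : cstarAlgType R) (H : hilbertModType A).
Variables (J : choiceType) (K : J -> set H) (L : J -> H -> H) (B : R).
Variable S : adjop H.
Hypothesis hK : forall j, closed_submodule (K j).
Hypothesis hL : forall j, adjointable_into (K j) (L j).
Hypothesis B0 : 0 < B.
Hypothesis sS : star S = S.
Implicit Types (g : J -> H) (f h : H) (F : {fset J}).

Let term g j := S (adjoint (L j) (g j)).
Let frame f j := inner (L j (S f)) (L j (S f)).
Let bessel := forall f F, cpos (B%:C%C *: inner f f - partial_sum (frame f) F).

Let S_sym f h : inner (S f) h = inner f (S h).
Proof. by rewrite adj_inner -star_adjopE sS. Qed.

Let inner_term g j h : K j (g j) ->
  inner (term g j) h = inner (g j) (L j (S h)).
Proof.
by move=> Kg; rewrite S_sym -inner_star -(adjointP (hL j))// inner_star.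
Qed.

Let l2_norm_sqr g : l2_norm g ^+ 2 = `|l2_inner g g|.
Proof. by rewrite sqr_sqrtr. Qed.

(** For the finite sum h, (h, h) is the sum of the (g_j, L_j S h). Cauchy-Schwarz and the Bessel
    bound at h give |h|^4 <= |sum of (g_j, g_j)| B |h|^2. *)
Lemma finite_synthesis_le g F : bessel -> (forall j, K j (g j)) ->
  `|partial_sum (term g) F| ^+ 2 <=
  B * `|partial_sum (fun j => inner (g j) (g j)) F|.
Proof.
move=> hb Kg; set h := partial_sum _ _.
have hh : inner h h = partial_sum (fun j => inner (g j) (L j (S h))) F.
  rewrite {1}/h /partial_sum inner_suml; apply: eq_bigr => i _.
  by rewrite inner_term.
have := cauchy_schwarz_sum g (fun j => L j (S h)) F; rewrite -hh norm_inner_self.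
have : `|partial_sum (frame h) F| <= B * `|h| ^+ 2.
  rewrite -norm_inner_self -[X in X * _]gtr0_norm// -norm_scaler.
  by apply: cpos_le; [apply: cpos_partial_sum => j; exact: inner_pos|exact: hb].
set x := `|partial_sum (fun j => inner (g j) (g j)) F|.
have x0 : 0 <= x by exact: normr_ge0.
set y := `|partial_sum (frame h) F| => yh xy.
have [->|n0] := eqVneq `|h| 0; first by rewrite expr0n mulr_ge0// ltW.
have p0 : 0 < `|h| ^+ 2 by rewrite exprn_gt0// lt_def n0 normr_ge0.
rewrite -(ler_pM2r p0) -[X in X <= _]expr2 (le_trans xy)//.
by rewrite mulrAC (mulrC _ x) ler_wpM2l.
Qed.

Lemma synthesis_summable g : bessel -> l2 K g -> usummable (term g).
Proof.
move=> hb [Kg sg]; apply: usummable_complete; first exact: hilbert_complete.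
move=> e e0; have e1 : 0 < e ^+ 2 / B by rewrite divr_gt0// exprn_gt0.
have [F0 hF0] := usummable_small sg e1; exists F0 => F F0F.
rewrite -(@ltr_sqr R) ?nnegrE ?(ltW e0)//.
rewrite (le_lt_trans (finite_synthesis_le _ hb Kg))//.
by rewrite mulrC -ltr_pdivlMr// hF0.
Qed.

Lemma synthesis_le g : bessel -> l2 K g ->
  `|usum (term g)| <= Num.sqrt B * l2_norm g.
Proof.
move=> hb gl2; have [Kg sg] := gl2; have st := synthesis_summable hb gl2.
apply: (@ler_add_eps _ _ _ (1 + Num.sqrt B)) => [|d d0].
  by rewrite addr_ge0// sqrtr_ge0.
(* The tolerance for the inner squares is d^2 because |q| <= n^2 + d^2 <= (n + d)^2 for n =
   [l2_norm g]. *)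
have d2 : 0 < d ^+ 2 by rewrite exprn_gt0.
have /cvgr_dist_lt/(_ _ d0) n1 := st; have /cvgr_dist_lt/(_ _ d2) n2 := sg.
near (@totally J) => F.
have h1 : `|usum (term g) - partial_sum (term g) F| < d by near: F.
have : `|l2_inner g g - partial_sum (fun j => inner (g j) (g j)) F| < d ^+ 2.
  by near: F.
set q := partial_sum (fun j => inner (g j) (g j)) F => h2.
have hq : `|q| <= (l2_norm g + d) ^+ 2.
  rewrite sqrrD l2_norm_sqr.
  have := ler_normB (l2_inner g g) (l2_inner g g - q).
  rewrite opprB addrC subrK.
  have : 0 <= l2_norm g * d by rewrite mulr_ge0 ?sqrtr_ge0// ltW.
  rewrite -mulr_natr; lra.
have hp : `|partial_sum (term g) F| <= Num.sqrt B * (l2_norm g + d).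
  have n0 : 0 <= l2_norm g + d by rewrite addr_ge0 ?sqrtr_ge0// ltW.
  rewrite -(@ler_sqr R) ?nnegrE ?mulr_ge0 ?sqrtr_ge0// exprMn sqr_sqrtr ?(ltW B0)//.
  by rewrite (le_trans (finite_synthesis_le F hb Kg))// ler_wpM2l// ltW.
have := ler_normD (usum (term g) - partial_sum (term g) F) (partial_sum (term g) F).
rewrite subrK; lra.
Unshelve. all: by end_near. Qed.

Lemma synthesis_linear (a : A) g g' : bessel -> l2 K g -> l2 K g' ->
  usum (term (fun j => a *: g j + g' j)) = a *: usum (term g) + usum (term g').
Proof.
move=> hb gl2 gl2'.
have /cvgr_dist_lt cg := synthesis_summable hb gl2.
have /cvgr_dist_lt cg' := synthesis_summable hb gl2'.
apply: norm_cvg_lim; apply/cvgrPdist_lt => e e0.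
have e1 : 0 < e / 2 / (`|a| + 1) by rewrite !divr_gt0// ltr_wpDl.
have e2 : 0 < e / 2 by rewrite divr_gt0.
near=> F.
have h1 : `|usum (term g) - partial_sum (term g) F| < e / 2 / (`|a| + 1).
  by near: F; exact: cg.
have h2 : `|usum (term g') - partial_sum (term g') F| < e / 2.
  by near: F; exact: cg'.
have -> : partial_sum (term (fun j => a *: g j + g' j)) F =
    a *: partial_sum (term g) F + partial_sum (term g') F.
  rewrite /partial_sum scaler_sumr -big_split; apply: eq_bigr => i _ /=.
  have [[Kg _] [Kg' _]] := (gl2, gl2').
  by rewrite /term (adjoint_lin a (hL _) (hK _))// adjopD adjopZ.
rewrite opprD addrACA -scalerBr (le_lt_trans (ler_normD _ _))//.
rewrite [ltRHS](splitr e) ltrD//.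
rewrite (le_lt_trans (norm_act _ _))//.
move: h1; rewrite ltr_pdivlMr ?ltr_wpDl//; apply: le_lt_trans.
by rewrite mulrC ler_wpM2l// lerDl.
Unshelve. all: by end_near. Qed.

Lemma l2_zero : l2 K (fun=> 0).
Proof.
split=> [j|]; first by case: (hK j).
by apply: (proj1 (@usum_finite _ _ _ _ fset0 _)) => j _; rewrite inner0l.
Qed.

Lemma bessel_synthesis : bessel ->
  [/\ forall g, l2 K g -> usummable (term g),
      l2_bounded_operator K (usum \o term)
    & l2_opnorm K (usum \o term) <= Num.sqrt B].
Proof.
move=> hb; split.
- by move=> g; exact: synthesis_summable.
- split=> [a g h gl2 hl2|]; first exact: synthesis_linear.
  by exists (Num.sqrt B) => g; exact: synthesis_le.
- apply: ge_sup => [|_ [g [gl2 g1] <-]].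
    (* Bounding a supremum requires a nonempty set; the zero family provides a member. *)
    exists `|usum (term (fun=> 0))|, (fun=> 0) => //.
    split; first exact: l2_zero.
    rewrite /l2_norm /l2_inner (proj2 (@usum_finite _ _ _ _ fset0 _)).
      by rewrite partial_sumE big_seq_fset0 normr0 sqrtr0.
    by move=> j _; rewrite inner0l.
  rewrite (le_trans (synthesis_le hb gl2))// ler_piMr// sqrtr_ge0.
Qed.

(** The operator is tested on finitely supported families. The bound M makes the set defining
    [l2_opnorm] bounded, so that its [sup] is an upper bound and not a default value. *)
Lemma synthesis_bessel :
  (exists M, forall g, l2 K g -> `|usum (term g)| <= M * l2_norm g) ->
  l2_opnorm K (usum \o term) <= Num.sqrt B -> bessel.
Proof.
move=> [M hM] hB f0 F; pose D j := adjoint (L j) \o L j.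
pose Q f := \sum_(j <- F) S (D j (S f)).
(* This test family is mapped to Q f, and its squared l2 norm is |(Q f, f)|. *)
pose g f j := if j \in F then L j (S f) else 0.
have Q_inner f h : inner (Q f) h = \sum_(j <- F) inner (L j (S f)) (L j (S h)).
  rewrite inner_suml; apply: eq_bigr => j _.
  rewrite S_sym -inner_star -(adjointP (hL j)) ?inner_star//.
  by case: (hL j).
have Q_sym f h : inner (Q f) h = inner f (Q h).
  rewrite -(inner_star (Q h) f) !Q_inner (big_morph star (@starD R A) (star0 A)).
  by apply: eq_bigr => j _; rewrite inner_star.
have Qf f : partial_sum (frame f) F = inner (Q f) f.
  by rewrite partial_sumE Q_inner.
have gg f : usummable (fun j => inner (g f j) (g f j)) /\
    usum (fun j => inner (g f j) (g f j)) = inner (Q f) f.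
  have [|cvg_g ->] := @usum_finite R J A (fun j => inner (g f j) (g f j)) F.
    by move=> j /negPf jF; rewrite /g jF inner0l.
  split=> //; rewrite -Qf !partial_sumE big_seq [RHS]big_seq.
  by apply: eq_bigr => j jF; rewrite /g jF.
have gl2 f : l2 K (g f).
  split=> [j|]; last by case: (gg f).
  by rewrite /g; case: ifP => _; [case: (hL j)|case: (hK j)].
have gn f : l2_norm (g f) ^+ 2 = `|inner (Q f) f|.
  by rewrite l2_norm_sqr /l2_inner (gg f).2.
have adj0 j : adjoint (L j) 0 = 0.
  apply: inner_inj => h; rewrite -(adjointP (hL j)) ?inner0r//.
  by case: (hK j).
have Tg f : usum (term (g f)) = Q f.
  rewrite (proj2 (@usum_finite _ _ _ _ F _)).
    rewrite partial_sumE /Q big_seq [RHS]big_seq.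
    by apply: eq_bigr => j jF; rewrite /term /g jF.
  by move=> j /negPf jF; rewrite /term /g jF adj0 adjop0.
have QZ (c : A) f : Q (c *: f) = c *: Q f.
  by apply: inner_injl => h; rewrite inner_scalel !Q_sym inner_scalel.
have Q_l2 f : `|Q f| <= Num.sqrt B * l2_norm (g f).
  (* A family of norm zero cannot be normalised; there the bound by M already gives Q f = 0. *)
  have [n0|n0] := eqVneq (l2_norm (g f)) 0.
    by have := hM _ (gl2 f); rewrite Tg n0 !mulr0.
  set n := l2_norm (g f) in n0 *.
  have n1 : 0 < n by rewrite lt_def n0 sqrtr_ge0.
  pose f1 := hscale n^-1%:C%C f.
  have Qf1 : Q f1 = hscale n^-1%:C%C (Q f) by rewrite /hscale -QZ.
  have rn : complex.Re `|n^-1%:C%C| = n^-1.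
    by rewrite normc_def /= expr0n addr0 sqrtr_sqr ger0_norm// invr_ge0 ltW.
  have f1n : l2_norm (g f1) <= 1.
    rewrite -(@ler_sqr R) ?nnegrE ?sqrtr_ge0// gn Qf1 expr1n.
    rewrite inner_hscalel inner_hscaler conjc_real !norm_scaler -gn -/n.
    rewrite gtr0_norm ?invr_gt0// expr2 mulKf// mulVf//.
  have sup_ub : `|Q f1| <= l2_opnorm K (usum \o term).
    apply: ub_le_sup; last by exists (g f1); [split|rewrite /= Tg].
    exists `|M| => _ [k [kl2 k1] <-]; rewrite (le_trans (hM k kl2))//.
    rewrite (le_trans (ler_norm _))// normrM ler_piMr//.
    by rewrite ger0_norm ?sqrtr_ge0.
  move: (le_trans sup_ub hB); rewrite Qf1 norm_hscale rn.
  by rewrite ler_pdivrMl// mulrC.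
have Q_le f : `|Q f| <= B * `|f|.
  have [->|n0] := eqVneq `|Q f| 0; first by rewrite mulr_ge0// ltW.
  have p0 : 0 < `|Q f| by rewrite lt_def n0 normr_ge0.
  rewrite -(ler_pM2r p0) -expr2 -mulrA.
  apply: (@le_trans _ _ (B * `|inner (Q f) f|)).
    rewrite -gn -[X in X * _](sqr_sqrtr (ltW B0)) -exprMn.
    by rewrite (@ler_sqr R) ?nnegrE ?mulr_ge0 ?sqrtr_ge0.
  by rewrite ler_wpM2l ?(ltW B0)// mulrC cauchy_schwarz.
have Qb : bounded_op Q by exists B.
pose T := AdjOp Q_sym Qb; have sT : star T = T by exact: adjopP.
have nT : `|T| <= B by apply: norm_adjop_le => //; exact: ltW.
(* The operator B - Q is positive in the algebra of operators; evaluated at f0, this is the A-valued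
   inequality. *)
have /positive_opP/(_ f0) := cpos_norm_sub sT nT.
by rewrite adjopBE innerBl adjopZE inner_hscalel Qf.
Qed.

End Synthesis.

(** * The equivalence for controlled sequences *)

Theorem theorem3p3 (R : realType) (A : cstarAlgType R) (H : hilbertModType A)
  (J : choiceType) (K : J -> set H) (C C' : H -> H) (L : J -> H -> H) (B : R)
  (hK : forall j, closed_submodule (K j))
  (hC : GLpos C) (hC' : GLpos C')
  (hL : forall j, adjointable_into (K j) (L j))
  (hCC' : C \o C' = C' \o C)
  (hCL : forall j, C \o (adjoint (L j) \o L j) = (adjoint (L j) \o L j) \o C)
  (hC'L : forall j, C' \o (adjoint (L j) \o L j) = (adjoint (L j) \o L j) \o C')
  (hB : 0 < B) :
  controlled_gBessel C C' L B <->
  [/\ synthesis_well_defined K C C' L,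
      l2_bounded_operator K (synthesis C C' L)
    & l2_opnorm K (synthesis C C' L) <= Num.sqrt B].
Proof.
have [lC bC pC _] := hC; have [lC' bC' pC' _] := hC'.
have [c cpos_c cE] := positive_op_adjop lC bC pC.
have [c' cpos_c' c'E] := positive_op_adjop lC' bC' pC'.
have cc' : c * c' = c' * c.
  by apply: adjopP => f; move: (congr1 (fun T => T f) hCC'); rewrite -cE -c'E.
have [S [cpos_S SE SS]] := op_sqrtP (cposM cpos_c cpos_c' cc').
have {}SE : op_sqrt (C \o C') = S by rewrite -SE -cE -c'E.
have sS := cpos_sa cpos_S.
have S_sym f h : inner (S f) h = inner f (S h).
  by rewrite adj_inner -star_adjopE sS.
pose D j := adjoint (L j) \o L j.
have LD j f h : inner (L j f) (L j h) = inner f (D j h).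
  by apply: (adjointP (hL j)); case: (hL j).
have D_sym j f h : inner (D j f) h = inner f (D j h).
  by rewrite -inner_star -LD inner_star LD.
have DS j f : S (D j f) = D j (S f).
  (* [D j] is a symmetric map without a given norm bound, so commutation with it is handled by
     [calculus_comm_adjoint]. It holds for S^2 = C C' and descends to S. *)
  apply: (cpos_sqrt_calculus cpos_S (calculus_comm_adjoint (D_sym j))) => {}f.
  rewrite SS !adjopME cE c'E.
  have CD x : C (D j x) = D j (C x) by exact: (congr1 (fun T => T x) (hCL j)).
  have C'D x : C' (D j x) = D j (C' x) by exact: (congr1 (fun T => T x) (hC'L j)).
  by rewrite C'D CD.
have frameE j f : inner (L j (C f)) (L j (C' f)) = inner (L j (S f)) (L j (S f)).
  (* Both sides are brought to the inner product of C' C f and D_j f. *)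
  rewrite !LD -DS -S_sym -adjopME SS cc' adjopME cE c'E.
  have -> : D j (C' f) = C' (D j f).
    exact/esym/(congr1 (fun T => T f) (hC'L j)).
  by rewrite (positive_op_sym lC' pC').
have synthE : synthesis_term C C' L = fun g j => S (adjoint (L j) (g j)).
  by apply/funext => g; apply/funext => j; rewrite /synthesis_term SE.
pose frame f j := inner (L j (S f)) (L j (S f)).
have besselE : controlled_gBessel C C' L B <->
    forall f F, cpos (B%:C%C *: inner f f - partial_sum (frame f) F).
  (* In the form [frame f] the terms are inner squares, hence positive, as [usum_leP] requires. *)
  have frameE' f : (fun j => inner (L j (C f)) (L j (C' f))) = frame f.
    by apply/funext => j; exact: frameE.
  have leP f : usum_le (frame f) (B%:C%C *: inner f f) <->
      forall F, cpos (B%:C%C *: inner f f - partial_sum (frame f) F).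
    apply: usum_leP => [j|]; first exact: inner_pos.
    by rewrite star_scaler inner_star.
  rewrite /controlled_gBessel; split=> [[_ h] f|h].
    by apply/leP; rewrite -frameE'.
  by split=> // f; rewrite frameE'; apply/leP.
rewrite /synthesis_well_defined /synthesis synthE besselE.
split=> [h|[_ [_ hM] h]].
  exact: bessel_synthesis.
exact: synthesis_bessel hM h.
Qed.
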